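(* Let $W \subset \mathbb{R}^2$ be the Warsaw Circle. Then its Milnor-Thurston homology groups satisfy $\mathcal{H}_n(W) = 0$ for every $n > 0$.
   Context: The Warsaw Circle $W \subset \mathbb{R}^2$ is the union of: the portion of the topologist's sine curve $\{(x,y) : y = \sin(1/x),\ x>0\}$ between the line $x=0$ and its rightmost minimum; the segment $\{(0,y) : -1 \leq y \leq 1\}$; and an arc (disjoint from the rest except at endpoints) joining $(0,-1)$ to that rightmost minimum. Milnor-Thurston (measure) homology: for a topological space $X$ and integer $k \geq 0$, let $C^0(\Delta^k, X)$ be the space of continuous maps from the standard $k$-simplex $\Delta^k$ to $X$, with the compact-open topology. $\mathcal{C}_k(X)$ is the real vector space of finite signed Borel measures on $C^0(\Delta^k,X)$ admitting a compact carrier (a set whose complement contains only Borel sets of measure zero). The boundary $\partial : \mathcal{C}_k(X) \to \mathcal{C}_{k-1}(X)$ is $\partial = \sum_{i=0}^k (-1)^i \partial_i$, where $\partial_i \mu$ is the image measure $A \mapsto \mu(\{\sigma : \sigma\circ\delta_i \in A\})$, with $\delta_i : \Delta^{k-1} \to \Delta^k$ the standard inclusion of the $i$-th face. The homology $\mathcal{H}_*(X)$ of this chain complex is the Milnor-Thurston homology of $X$. *)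

(* Defs.v *)
From HB Require Import structures.
From mathcomp Require Import all_boot all_order all_algebra.
From mathcomp Require Import all_classical all_reals all_analysis.
Unset Printing Implicit Defensive.
Import Order.TTheory GRing.Theory Num.Theory.
Import numFieldNormedType.Exports.
Local Open Scope classical_set_scope.
Local Open Scope ring_scope.

Section Defs.
Variable R : realType.

(* rightmost minimum of sin(1/x): 1/x = 3 pi / 2, i.e. x = 2/(3 pi) *)
Definition x_min : R := 2 / (3 * pi).

Definition sine_part : set ((R * R)%type) :=
  [set p | 0 < p.1 /\ p.1 <= x_min /\ p.2 = sin (p.1^-1)].

Definition seg_part : set ((R * R)%type) :=
  [set p | p.1 = 0 /\ -1 <= p.2 <= 1].

Definition warsaw_arc (gamma : R -> (R * R)%type) : Prop :=
  {within `[0, 1], continuous gamma} /\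
  set_inj `[0, 1] gamma /\
  gamma 0 = (0, -1) /\ gamma 1 = (x_min, -1) /\
  (forall t, t \in `[0, 1] -> (sine_part `|` seg_part) (gamma t) ->
     t = 0 \/ t = 1).

Definition warsaw (gamma : R -> (R * R)%type) : set ((R * R)%type) :=
  sine_part `|` seg_part `|` gamma @` `[0, 1].

Definition Delta (k : nat) : set 'rV[R]_k.+1 :=
  [set x | (forall i, 0 <= x ord0 i) /\ \sum_(i < k.+1) x ord0 i = 1].

(* C^0(Delta^k, X) is represented by maps 'rV_(k+1) -> R*R, continuous on
   Delta^k, sending Delta^k into X, and normalized to 0 off Delta^k
   (so that they are in bijection with continuous maps Delta^k -> X). *)
Definition sing (X : set ((R * R)%type)) (k : nat) : set ('rV[R]_k.+1 -> (R * R)%type) :=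
  [set s | {within (Delta k), continuous s} /\ s @` (Delta k) `<=` X /\
           (forall x, ~ (Delta k) x -> s x = 0)].

Definition co_subbasic (X : set ((R * R)%type)) (k : nat)
    (KU : set 'rV[R]_k.+1 * set ((R * R)%type)) : set ('rV[R]_k.+1 -> (R * R)%type) :=
  [set s | sing X k s /\ s @` KU.1 `<=` KU.2].

Definition co_admissible (k : nat) (KU : set 'rV[R]_k.+1 * set ((R * R)%type)) : Prop :=
  compact KU.1 /\ KU.1 `<=` (Delta k) /\ open KU.2.

Definition co_open (X : set ((R * R)%type)) (k : nat)
    (O : set ('rV[R]_k.+1 -> (R * R)%type)) : Prop :=
  O `<=` sing X k /\
  forall s, O s -> exists (n : nat) (KU : 'I_n -> set 'rV[R]_k.+1 * set ((R * R)%type)),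
    (forall j, co_admissible k (KU j)) /\
    (sing X k `&` \bigcap_j co_subbasic X k (KU j)) s /\
    sing X k `&` \bigcap_j co_subbasic X k (KU j) `<=` O.

Definition co_compact (X : set ((R * R)%type)) (k : nat)
    (K : set ('rV[R]_k.+1 -> (R * R)%type)) : Prop :=
  K `<=` sing X k /\
  forall (I : Type) (O : I -> set ('rV[R]_k.+1 -> (R * R)%type)),
    (forall i, co_open X k (O i)) -> K `<=` \bigcup_i O i ->
    exists (n : nat) (f : 'I_n -> I), K `<=` \bigcup_j O (f j).

Definition co_borel (X : set ((R * R)%type)) (k : nat) :
    set (set ('rV[R]_k.+1 -> (R * R)%type)) :=
  <<s sing X k, co_open X k >>.

Definition mt_chain (X : set ((R * R)%type)) (k : nat)
    (mu : set ('rV[R]_k.+1 -> (R * R)%type) -> R) : Prop :=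
  (forall F : nat -> set ('rV[R]_k.+1 -> (R * R)%type),
     (forall n, co_borel X k (F n)) -> trivIset setT F ->
     (fun n => \sum_(i < n) mu (F i)) @ \oo --> mu (\bigcup_n F n)) /\
  (exists K, co_compact X k K /\
     forall B, co_borel X k B -> B `&` K = set0 -> mu B = 0).

Definition face (k : nat) (i : 'I_k.+2) (x : 'rV[R]_k.+1) : 'rV[R]_k.+2 :=
  \row_(j < k.+2) (if (j < i)%N then x ord0 (inord j)
                   else if (j == i :> nat) then 0 else x ord0 (inord j.-1)).

Definition mt_boundary (X : set ((R * R)%type)) (k : nat)
    (mu : set ('rV[R]_k.+2 -> (R * R)%type) -> R) :
    set ('rV[R]_k.+1 -> (R * R)%type) -> R :=
  fun A => \sum_(i < k.+2)
     (-1) ^+ i * mu [set s | sing X k.+1 s /\ A (s \o face k i)].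

(* H_(m+1)(X) = 0: every Milnor-Thurston (m+1)-cycle is a boundary.
   Measures are compared on Borel sets (where they are defined). *)
Definition mt_homology_succ_vanishes (X : set ((R * R)%type)) (m : nat) : Prop :=
  forall mu : set ('rV[R]_m.+2 -> (R * R)%type) -> R,
    mt_chain X m.+1 mu ->
    (forall A, co_borel X m A -> mt_boundary X m mu A = 0) ->
    exists nu : set ('rV[R]_m.+3 -> (R * R)%type) -> R,
      mt_chain X m.+2 nu /\
      forall A, co_borel X m.+1 A -> mt_boundary X m.+1 nu A = mu A.
End Defs.

(* Main.v *)
Require Import Defs.
From HB Require Import structures.
From mathcomp Require Import all_boot all_order all_algebra.
From mathcomp Require Import all_classical all_reals all_analysis.
From mathcomp Require Import zify ring lra.

(* The Warsaw circle W is a continuous bijective image [unroll] of the half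
   line [0, +oo[, and every path of small diameter in W has small image under
   the inverse map [height]. Hence every singular simplex lifts to the half
   line, and the lifts of a compact family of simplices are equicontinuous and
   oscillate by at most some constant D, although they may escape to infinity.

   Cut the half line into blocks of length D, let b(s) be the index of the
   highest block met by the lift of s, put p_b = unroll (b D), and write p * s
   for the cone with apex p, formed affinely in the half line. For a face t of
   s, either b(t) = b(s) or b(t) = b(s) - 1. For a cycle mu put
     nu = [p_b(s) * s] mu + sum_i (-1)^i [p_(b+1) * p_b * d_i s] mu,
   where the second pushforward is restricted to the s with
   b(d_i s) = b(s) = b. All cones involved have lifts of bounded oscillation,
   so nu has a compact carrier. In the boundary of nu, the cones over the faces
   cancel by the cycle condition, up to the joins p_(b+1) * p_b * d_j d_i s;
   these vanish too because, for each b, the faces in block b carry the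
   boundary of the restriction of mu to the simplices of index at most b. *)

Set Implicit Arguments.
Unset Strict Implicit.
Unset Printing Implicit Defensive.
Import Order.TTheory GRing.Theory Num.Theory.
Import numFieldNormedType.Exports.
Local Open Scope classical_set_scope.
Local Open Scope ring_scope.

(** * Spaces of singular simplices *)

(** One fixed apex cannot work: the constant simplices at all points of the circle form a compact
    family with unbounded lifts, and their cones to a fixed point run through arbitrarily many
    oscillations of the sine curve, so they are not equicontinuous and lie in no compact family.
    Hence the apex follows the simplex. The index b jumps, but it is a Borel function with countably
    many values, and pushing measures forward needs Borel maps only. The price is that a face may
    have another apex than its simplex. If a face t of s drops a block, its cone in the boundary
    already has apex p_(b(t)+1); if it stays, the join p_(b+1) * p_b * t trades p_b for p_(b+1). So
    every cone over a face t ends with an apex that depends on t alone, and the cycle condition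
    applies to the pushforward. The common oscillation bound D as block length makes a face drop by
    at most one block and keeps each apex p_b within D of the lift. *)

Lemma within_continuousP (R : realType) (U V : normedModType R)
    (A : set U) (f : U -> V) :
  {within A, continuous f} <->
  forall x, A x -> forall e : R, 0 < e -> exists2 d : R, 0 < d &
    forall y, A y -> `|x - y| < d -> `|f x - f y| < e.
Proof.
split=> [/subspace_continuousP cf x Ax e e0|cf].
  have /cvgrPdist_lt/(_ e e0) := cf x Ax.
  rewrite /prop_near1 /within /= => /nbhs_normP[d /= d0 Hd].
  by exists d => // y Ay xy; apply: Hd.
apply/subspace_continuousP => x Ax; apply/cvgrPdist_lt => e e0.
have [d d0 Hd] := cf x Ax e e0.
by apply/nbhs_normP; exists d => //= y xy Ay; apply: Hd.
Qed.

(** The Lebesgue number principle in filter form: near-covering compactness, along positive [e]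
    tending to 0, merges the local thresholds [d] into one. *)
Lemma compact_uniform (R : realType) (U : normedModType R) (K : set U)
    (P : R -> U -> Prop) : compact K ->
  (forall x, K x -> exists2 d : R, 0 < d &
     forall e y, 0 < e < d -> `|x - y| < d -> P e y) ->
  exists2 e : R, 0 < e & forall y, K y -> P e y.
Proof.
move=> /compact_near_coveringP cK HP.
have [|/= e e0 He] := cK R 0^'+ P _.
  move=> x Kx; have [d d0 Hd] := HP x Kx.
  exists ([set y | `|x - y| < d], [set e | 0 < e < d]) => /=.
    split; first by apply/nbhs_normP; exists d.
    near=> e => /=; apply/andP; split; near: e; first exact: nbhs_right_gt.
    exact: nbhs_right_lt.
  by move=> [y e] /= [xy ed]; exact: Hd.
have h : e / 2 < e by rewrite ltr_pdivrMr // ltr_pMr // ltr1n.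
exists (e / 2); first by rewrite divr_gt0.
apply: He => /=; last by rewrite divr_gt0.
by rewrite sub0r normrN gtr0_norm // divr_gt0.
Unshelve. all: by end_near. Qed.

Lemma compact_within_uniform (R : realType) (U V : normedModType R)
    (K : set U) (f : U -> V) : compact K -> {within K, continuous f} ->
  forall e : R, 0 < e -> exists2 d : R, 0 < d &
    forall x y, K x -> K y -> `|x - y| < d -> `|f x - f y| < e.
Proof.
move=> cK /within_continuousP cf e e0.
have [|d d0 Hd] := @compact_uniform R U K (fun d x => K x ->
    forall y, K y -> `|x - y| < d -> `|f x - f y| < e) cK.
  move=> x Kx; have [|d d0 Hd] := cf x Kx (e / 2); first lra.
  exists (d / 2) => [|e' y /andP[_ e'd] xy Ky z Kz yz].
    by rewrite divr_gt0.
  rewrite -(subrKA (f x)) (splitr e) (le_lt_trans (ler_normD _ _)) //.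
  rewrite ltrD // ?[`|f y - _|]distrC Hd //.
    by rewrite (lt_le_trans xy) // ler_pdivrMr // ler_pMr // ler1n.
  rewrite -(subrKA y) (le_lt_trans (ler_normD _ _)) // (splitr d) ltrD //.
  exact: lt_trans e'd.
by exists d => // x y Kx; exact: Hd.
Qed.

Section MappingSpaces.
Context {R : realType}.
Implicit Types (X : set (R * R)) (k : nat).

Lemma Delta_coord k (x : 'rV[R]_k.+1) i : Delta R k x -> 0 <= x ord0 i <= 1.
Proof.
move=> [x0 x1]; rewrite x0 /= -x1 (bigD1 i) //= lerDl.
by rewrite sumr_ge0 // => j _; exact: x0.
Qed.

Lemma rV_norm_le n (x : 'rV[R]_n) (c : R) : 0 <= c ->
  (forall i, `|x ord0 i| <= c) -> `|x| <= c.
Proof.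
move=> c0 h; rewrite [`|x|]mx_normrE.
by apply: bigmax_le => // -[i j] _ /=; rewrite ord1 h.
Qed.

Lemma rV_coord_le n (x : 'rV[R]_n) i : `|x ord0 i| <= `|x|.
Proof.
rewrite [`|x|]mx_normrE.
exact: (le_bigmax _ (fun ij : 'I_1 * 'I_n => `|x ij.1 ij.2|) (ord0, i)).
Qed.

Lemma Delta_dist k (x y : 'rV[R]_k.+1) :
  Delta R k x -> Delta R k y -> `|x - y| <= 1.
Proof.
move=> Dx Dy; apply: rV_norm_le => // i; rewrite !mxE.
have := Delta_coord i Dx; have := Delta_coord i Dy.
by rewrite ler_norml; lra.
Qed.

Lemma Delta_compact k : compact (Delta R k).
Proof.
apply: bounded_closed_compact.
  exists 1; split=> // M M1 x Dx.
  apply: rV_norm_le; first by rewrite ltW // (lt_trans _ M1).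
  move=> i; have /andP[h0 h1] := Delta_coord i Dx.
  by rewrite ger0_norm // (le_trans h1) // ltW.
have -> : Delta R k =
    \bigcap_(i in [set: 'I_k.+1]) [set x : 'rV[R]_k.+1 | 0 <= x ord0 i] `&`
    [set x | \sum_(i < k.+1) x ord0 i = 1].
  by apply/seteqP; split=> x /= [h ?]; split=> // i; [move=> _|]; apply: h.
have cont i : continuous (fun x : 'rV[R]_k.+1 => x ord0 i).
  exact: coord_continuous.
apply: closedI; first apply: closed_bigI => i _.
  exact: (preimage_closed (fun _ _ => cont i _) (@closed_ge R 0)).
pose f (x : 'rV[R]_k.+1) := \sum_(i < k.+1) x ord0 i.
apply: (@preimage_closed _ _ f _ _ (@closed_eq R 1)) => x _.
by apply: continuous_big => [|i _]; [exact: add_continuous|exact: cont].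
Qed.

Lemma Delta_net k (d : R) : 0 < d ->
  exists n (x : 'I_n -> 'rV[R]_k.+1), (forall j, Delta R k (x j)) /\
    forall y, Delta R k y -> exists j, `|x j - y| < d.
Proof.
move=> d0; have := @Delta_compact k; rewrite compact_cover => /(_ _ (Delta R k)
  (fun x => [set y | `|x - y| < d])) [].
- move=> x _; have -> : [set y | `|x - y| < d] = ball x d by rewrite -ball_normE.
  exact: ball_open.
- by move=> x Dx; exists x => //=; rewrite subrr normr0.
move=> D' sD cD.
have /finite_seqP[s Es] := finite_fset D'.
exists (size s), (fun j => nth 0 s j); split.
  move=> j; have : [set` s] (nth 0 s j) by rewrite /= mem_nth.
  by rewrite -Es => /sD/set_mem.
move=> y /cD; rewrite Es => -[x /= xs0 xy].
have xs : (index x s < size s)%N by rewrite index_mem.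
by exists (Ordinal xs); rewrite /= nth_index.
Qed.

Local Notation simp k := ('rV[R]_k.+1 -> R * R).

Definition unif_near k (e : R) (s t : simp k) :=
  forall x, Delta R k x -> `|s x - t x| < e.

Definition equicont (V : normedModType R) k (F : set ('rV[R]_k.+1 -> V)) :=
  forall e : R, 0 < e -> exists2 d : R, 0 < d & forall s, F s ->
    forall x y, Delta R k x -> Delta R k y -> `|x - y| < d -> `|s x - s y| < e.

Lemma sing_equicont X k (s : simp k) : sing R X k s -> equicont [set s].
Proof.
move=> [cs _] e e0.
have [d d0 Hd] := compact_within_uniform (@Delta_compact k) cs e0.
by exists d => // _ ->.
Qed.

Lemma sing_in X k (s : simp k) x : sing R X k s -> Delta R k x -> X (s x).
Proof. by move=> [_ [h _]] Dx; apply: h; exists x. Qed.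

(** Over the compact simplex the compact-open topology is that of uniform convergence. One way, a
    compact image inside an open set keeps a positive distance from its complement; the other way, a
    finite net controls a uniformly continuous map. *)
Lemma co_openP X k (O : set (simp k)) :
  co_open R X k O <-> O `<=` sing R X k /\ forall s, O s ->
    exists2 e : R, 0 < e &
      forall t, sing R X k t -> unif_near e s t -> O t.
Proof.
split=> -[OX HO]; split=> // s Os; have Xs := OX s Os.
  have [n [KU [admKU [[_ KUs] sub]]]] := HO s Os.
  have /choice[e He] j : exists e : R, 0 < e /\ forall t, unif_near e s t ->
      t @` (KU j).1 `<=` (KU j).2.
    have [cK [KD oU]] := admKU j.
    have [|e e0 He] := @compact_uniform R _ (KU j).1
      (fun e x => (KU j).1 x -> forall y, `|s x - y| < e -> (KU j).2 y) cK.
      move=> x Kx; have /nbhs_normP[r /= r0 Hr] : nbhs (s x) (KU j).2.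
        apply: open_nbhs_nbhs; split=> //.
        by apply: (KUs j I).2; exists x.
      have r20 : 0 < r / 2 by rewrite divr_gt0.
      have /within_continuousP/(_ x (KD _ Kx) _ r20)[d d0 Hd] := Xs.1.
      exists (Num.min (r / 2) d) => [|e y]; first by rewrite lt_min r20.
      rewrite lt_min => /andP[e0 /andP[er _]].
      rewrite lt_min => /andP[_ xyd] Ky z yz; apply: Hr => /=.
      rewrite -(subrKA (s y)) (splitr r) (le_lt_trans (ler_normD _ _)) //.
      by rewrite ltrD // ?(lt_trans yz) // Hd //; apply: KD.
    exists e; split=> // t st _ [x Kx <-].
    by apply: (He x Kx) => //; apply: st; apply: KD.
  exists (\big[Num.min/1]_(j < n) e j) => [|t Xt st].
    by apply: lt_bigmin => // i _; case: (He i).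
  apply: sub; split=> // j _; split=> //; apply: (He j).2 => x Dx.
  by apply: (lt_le_trans (st x Dx)); exact: bigmin_le.
have [e e0 He] := HO s Os.
have e20 : 0 < e / 2 by rewrite divr_gt0.
have [d d0 Hd] := sing_equicont Xs e20.
have d20 : 0 < d / 2 by rewrite divr_gt0.
(* Closed balls of radius d/2 around a d/2-net cover the simplex, meet it in compact sets, and stay
   inside the open d-balls where [s] moves by less than e/2. *)
have [n [x [Dx Hx]]] := @Delta_net k _ d20.
exists n, (fun j => (Delta R k `&` closed_ball (x j) (d / 2),
                     ball (s (x j)) (e / 2))); split.
  move=> j; split=> /=.
    by apply: compact_closedI; [exact: Delta_compact|exact: closed_ball_closed].
  by split; [move=> ? []|exact: ball_open].
have xd j y : closed_ball (x j) (d / 2) y -> `|x j - y| < d.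
  rewrite closed_ballE // /closed_ball_ /= => /le_lt_trans; apply.
  by rewrite ltr_pdivrMr // ltr_pMr // ltr1n.
split.
  split=> // j _; split=> // _ [y [Dy /xd xy]] <- /=.
  by rewrite -ball_normE /ball_ /=; apply: Hd.
move=> t [Xt Ht]; apply: He => // y Dy.
have [j xjy] := Hx y Dy.
have /Ht[_ /= Hj] : [set: 'I_n] j by [].
have xjy' : closed_ball (x j) (d / 2) y by apply: subset_closed_ball; rewrite -ball_normE.
have : ball (s (x j)) (e / 2) (t y) by apply: Hj; exists y.
rewrite -ball_normE /ball_ /= => sty.
rewrite -(subrKA (s (x j))) (splitr e) (le_lt_trans (ler_normD _ _)) //.
by rewrite ltrD // distrC; apply: Hd => //; apply: xd.
Qed.

(** Finitely many uniform balls of radius e/3 cover [K], and each centre is uniformly continuous. *)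
Lemma co_compact_equicont X k (K : set (simp k)) :
  co_compact R X k K -> equicont K.
Proof.
move=> [KX cK] e e0; have e30 : 0 < e / 3 by lra.
(* The slack [r] below e/3 makes [O s] visibly open: half of the gap e/3 - r is room for a further
   perturbation. *)
pose O (s : simp k) := [set t | sing R X k s /\ sing R X k t /\
  exists2 r, 0 < r < e / 3 & unif_near r s t].
have [||n [f Kf]] := cK _ O.
- move=> s; apply/co_openP; split=> [t [_ []] //|t [Xs [Xt [r /andP[r0 re] st]]]].
  exists ((e / 3 - r) / 2) => [|t' Xt' tt']; first lra.
  split=> //; split=> //; exists (r + (e / 3 - r) / 2); first lra.
  move=> x Dx; rewrite -(subrKA (t x)) (le_lt_trans (ler_normD _ _)) //.
  by rewrite ltrD ?st ?tt'.
- move=> s Ks; exists s => //; split; [|split]; try exact: KX.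
  by exists (e / 6) => [|x Dx]; rewrite ?subrr ?normr0; lra.
have /choice[d Hd] (j : 'I_n) : exists d : R, 0 < d /\ forall x y,
    sing R X k (f j) -> Delta R k x -> Delta R k y -> `|x - y| < d ->
    `|f j x - f j y| < e / 3.
  have [Xs|nXs] := pselect (sing R X k (f j)); last by exists 1; split.
  have [d d0 Hd] := sing_equicont Xs e30.
  by exists d; split=> // x y _; apply: Hd.
exists (\big[Num.min/1]_(j < n) d j).
  by apply: lt_bigmin => // i _; case: (Hd i).
move=> s /Kf[j _ [Xs [Xt [r /andP[r0 re] st]]]] x y Dx Dy xy.
have h : `|f j x - f j y| < e / 3.
  by apply: (Hd j).2 => //; rewrite (lt_le_trans xy)//; exact: bigmin_le.
rewrite -(subrKA (f j x)) (le_lt_trans (ler_normD _ _)) //.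
rewrite -(subrKA (f j y) (f j x)).
have := ler_normD (f j x - f j y) (f j y - s y).
by have := st x Dx; have := st y Dy; rewrite (distrC (s x)); lra.
Qed.

(* Arzela-Ascoli: on an equicontinuous family the uniform and the pointwise
   topologies agree, so Tychonoff gives the compactness. *)
Lemma equicont_co_compact X k (F : set (simp k)) : compact X ->
  F `<=` sing R X k -> equicont F ->
  exists2 K, co_compact R X k K & F `<=` K.
Proof.
move=> cX FX eF.
have /choice[d Hd] (n : nat) : exists d : R, 0 < d /\ forall s, F s ->
    forall x y, Delta R k x -> Delta R k y -> `|x - y| < d ->
    `|s x - s y| < n.+1%:R^-1.
  have [|d d0 H] := eF n.+1%:R^-1; first by rewrite invr_gt0.
  by exists d.
(* Off the simplex the value is pinned to 0, the normalization in [sing]; thus [K] is a closed part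
   of a product of compact sets. *)
pose A (x : 'rV[R]_k.+1) := if `[< Delta R k x >] then X else [set 0].
pose C (i : nat * ('rV[R]_k.+1 * 'rV[R]_k.+1)) : set {ptws 'rV[R]_k.+1 -> (R * R)%type} :=
  [set s | `|s i.2.1 - s i.2.2| <= i.1.+1%:R^-1].
pose I := [set i : nat * ('rV[R]_k.+1 * 'rV[R]_k.+1) |
  [/\ Delta R k i.2.1, Delta R k i.2.2 & `|i.2.1 - i.2.2| < d i.1]].
pose K : set {ptws 'rV[R]_k.+1 -> (R * R)%type} :=
  [set s | forall x, A x (s x)] `&` \bigcap_(i in I) C i.
have cK : compact K.
  apply: compact_closedI.
    apply: (@tychonoff _ (fun _ => (R * R)%type) A) => x.
    by rewrite /A; case: ifP => _ //; exact: compact_set1.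
  apply: closed_bigI => -[n [x y]] _.
  rewrite /C /=.
  pose f (s : {ptws 'rV[R]_k.+1 -> (R * R)%type}) := `|s x - s y|.
  apply: (@preimage_closed _ _ f _ _ (@closed_le R n.+1%:R^-1)) => s _.
  have h z : (fun t : {ptws 'rV[R]_k.+1 -> (R * R)%type} => t z) @ s --> s z.
    exact: (@proj_continuous _ (fun=> (R * R)%type : topologicalType) z s).
  exact: (cvg_norm (cvgB (h x) (h y))).
have KX : K `<=` sing R X k.
  move=> s [As Cs]; split; last split.
  - apply/within_continuousP => x Dx e e0.
    have [n ne] : exists n : nat, n.+1%:R^-1 < e.
      exists (Num.truncn e^-1); rewrite invf_plt ?posrE //.
      by rewrite truncnS_gt.
    exists (d n) => [|y Dy xy]; first by case: (Hd n).
    by apply: le_lt_trans ne; exact: (Cs (n, (x, y))).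
  - by move=> _ [x Dx <-]; have := As x; rewrite /A asboolT.
  - by move=> x nDx; have := As x; rewrite /A asboolF.
exists K; last first.
  move=> s Fs; split=> [x|[n [x y]] [/= Dx Dy xy]].
    rewrite /A; case: asboolP => [Dx|nDx]; first exact: sing_in (FX _ Fs) Dx.
    by case: (FX _ Fs) => _ [_]; apply.
  by apply/ltW/(Hd n).2.
split=> // J O oO KO.
have [K0|/set0P[s0 Ks0]] := eqVneq K set0.
  have f0 (j : 'I_0) : J by case: j.
  by exists 0%N, f0; rewrite K0.
have [i0 _ _] := KO s0 Ks0.
pose T := {ptws 'rV[R]_k.+1 -> (R * R)%type}.
have /choice[g Hg] (s : T) : exists iU : J * set T,
    K s -> [/\ open iU.2, iU.2 s & K `&` iU.2 `<=` O iU.1].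
  have [Ks|nKs] := pselect (K s); last by exists (i0, set0).
  have [i _ Ois] := KO s Ks.
  have /co_openP[_ /(_ s Ois)[e e0 He]] := oO i.
  have [n ne] : exists n : nat, n.+1%:R^-1 < e / 3.
    exists (Num.truncn (e / 3)^-1); rewrite invf_plt ?posrE ?truncnS_gt //; lra.
  have [N [x [Dx Hx]]] := Delta_net k (Hd n).1.
  (* Closeness on a finite net suffices: [s] and [t] both lie in [K], so each moves by at most
     1/(n+1) < e/3 between a point and the net. *)
  exists (i, [set t : T | forall j : 'I_N, `|s (x j) - t (x j)| < e / 3]).
  move=> _; split=> /=.
  - rewrite openE => t /= Ut; rewrite /interior /=.
    suff h j : nbhs t [set t' : T | `|s (x j) - t' (x j)| < e / 3].
      exact: (filter_forall (nbhs_filter t) h).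
    have /cvgrPdist_lt/(_ (e / 3 - `|s (x j) - t (x j)|)) :=
      @proj_continuous _ (fun=> (R * R)%type : topologicalType) (x j) t.
    rewrite subr_gt0 => /(_ (nbhs_filter t) (Ut j)) H.
    apply: (@filterS _ _ (nbhs_filter t) _ _ _ H) => t' /=.
    rewrite /proj => tt'.
    by rewrite -(subrKA (t (x j))) (le_lt_trans (ler_normD _ _)) //; lra.
  - by move=> j /=; rewrite subrr normr0; lra.
  - move=> t [Kt Ht]; apply: He; first exact: KX.
    move=> y Dy; have [j xy] := Hx y Dy.
    have h1 : `|s (x j) - s y| <= n.+1%:R^-1.
      by apply: (Ks.2 (n, (x j, y))); split=> //; exact: Dx.
    have h2 : `|(t (x j) : R * R) - t y| <= n.+1%:R^-1.
      by apply: (Kt.2 (n, (x j, y))); split=> //; exact: Dx.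
    have := Ht j => /= h3.
    rewrite -(subrKA (s (x j))) (le_lt_trans (ler_normD _ _)) //.
    rewrite -(subrKA (t (x j)) (s (x j))).
    have := ler_normD (s (x j) - t (x j)) (t (x j) - t y).
    by move: n.+1%:R^-1 ne h1 h2 => c ne h1 h2; rewrite (distrC (s y)); lra.
pose pT : ptopologicalType := HB.pack_for ptopologicalType T
  (isPointed.Build T (fun=> 0)).
have : @cover_compact pT K by rewrite -compact_cover.
move=> /(_ _ K (fun s => (g s).2)) [].
- by move=> s /Hg[].
- by move=> s Ks; exists s => //; have [] := Hg s Ks.
move=> D' sD cD.
have /finite_seqP[l El] := finite_fset D'.
exists (size l), (fun j => (g (nth s0 l j)).1) => s Ks.
have := cD s Ks; rewrite El => -[t /= tl gs].
have tl' : (index t l < size l)%N by rewrite index_mem.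
exists (Ordinal tl') => //=; rewrite nth_index //.
have Kt : K t by have : [set` l] t by []; rewrite -El => /sD/set_mem.
by have [_ _] := Hg t Kt; apply.
Qed.
End MappingSpaces.

(** * Borel sets and faces *)

Section BorelSets.
Context {R : realType}.
Implicit Types (X : set (R * R)) (k : nat).
Local Notation simp k := ('rV[R]_k.+1 -> R * R).

Lemma co_borel_sub X k A : co_borel R X k A -> A `<=` sing R X k.
Proof.
move: A; apply: smallest_sub; last by move=> O [].
by split=> [s []|A AX s []|A AX s [n _ /AX]].
Qed.

Lemma co_borelP X k : [/\ co_borel R X k (sing R X k),
  setSD_closed (co_borel R X k), ndseq_closed (co_borel R X k) &
  setI_closed (co_borel R X k)].
Proof.
by apply/(sigma_algebraP (@co_borel_sub X k)); exact: smallest_sigma_algebra.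
Qed.

Lemma co_borel_sing X k : co_borel R X k (sing R X k).
Proof. by have [] := co_borelP X k. Qed.

Lemma co_borelI X k A B :
  co_borel R X k A -> co_borel R X k B -> co_borel R X k (A `&` B).
Proof. by have [_ _ _] := co_borelP X k; apply. Qed.

Lemma co_borel_bigcup X k (A : nat -> set (simp k)) :
  (forall n, co_borel R X k (A n)) -> co_borel R X k (\bigcup_n A n).
Proof. exact: sigma_algebra_bigcup. Qed.

Lemma co_borelC X k A : co_borel R X k A -> co_borel R X k (sing R X k `\` A).
Proof. by have [_ + _] := @smallest_sigma_algebra _ (sing R X k) (co_open R X k); apply. Qed.

Lemma co_borelD X k A B :
  co_borel R X k A -> co_borel R X k B -> co_borel R X k (A `\` B).
Proof.
move=> bA bB; have -> : A `\` B = A `&` (sing R X k `\` B).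
  apply/seteqP; split=> s [As]; last by move=> [].
  by split=> //; split=> //; exact: co_borel_sub bA _ As.
by apply: co_borelI => //; exact: co_borelC.
Qed.

Lemma co_borel0 X k : co_borel R X k set0.
Proof. by have [] := @smallest_sigma_algebra _ (sing R X k) (co_open R X k). Qed.

Lemma co_borel_preimage X k l (E : set (simp k)) (f : simp k -> simp l) :
  co_borel R X k E -> (forall s, E s -> sing R X l (f s)) ->
  (forall O, co_open R X l O -> co_borel R X k (E `&` f @^-1` O)) ->
  forall A, co_borel R X l A -> co_borel R X k (E `&` f @^-1` A).
Proof.
move=> bE Ef fO; apply: smallest_sub; last exact: fO.
split=> [|A bA|A bA] /=.
- by rewrite preimage_set0 setI0; exact: co_borel0.
- have -> : E `&` f @^-1` (sing R X l `\` A) = E `\` (E `&` f @^-1` A).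
    apply/seteqP; split=> s [Es].
      by move=> [_ nA]; split=> // -[].
    by move=> nA; split=> //; split=> [|As]; [exact: Ef|apply: nA].
  exact: co_borelD.
- by rewrite preimage_bigcup setI_bigcupr; exact: co_borel_bigcup.
Qed.

(** Continuity is assumed only relative to [E]. The set [O'] is open in the whole space and has the
    same trace on [E] as the preimage of [O]. *)
Lemma co_borel_preimage_continuous X k l (E : set (simp k)) (f : simp k -> simp l) :
  co_borel R X k E -> (forall s, E s -> sing R X l (f s)) ->
  (forall s, E s -> forall e : R, 0 < e -> exists2 d : R, 0 < d &
    forall t, E t -> unif_near d s t -> unif_near e (f s) (f t)) ->
  forall A, co_borel R X l A -> co_borel R X k (E `&` f @^-1` A).
Proof.
move=> bE Ef cf; apply: co_borel_preimage => // O /co_openP[OX HO].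
pose O' := [set s | sing R X k s /\ exists2 d : R, 0 < d &
  forall t, E t -> unif_near d s t -> O (f t)].
have oO' : co_open R X k O'.
  apply/co_openP; split=> [s []//|s [Xs [d d0 Hd]]].
  exists (d / 2) => [|t Xt st]; first lra.
  split=> //; exists (d / 2) => [|t' Et' tt']; first lra.
  apply: Hd => // x Dx; rewrite -(subrKA (t x)) (splitr d).
  by rewrite (le_lt_trans (ler_normD _ _)) // ltrD ?st ?tt'.
suff -> : E `&` f @^-1` O = E `&` O'.
  by apply: co_borelI => //; exact: sub_sigma_algebra.
apply/seteqP; split=> s [Es].
  move=> Ofs; split=> //; split; first exact: co_borel_sub bE _ Es.
  have [e e0 He] := HO _ Ofs; have [d d0 Hd] := cf s Es e e0.
  by exists d => // t Et st; apply: He; [exact: Ef|exact: Hd].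
move=> [_ [d d0 Hd]]; split=> //; apply: Hd => // x Dx.
by rewrite subrr normr0.
Qed.

Lemma co_borel_closed X k (C : set (R * R)) : closed C ->
  co_borel R X k [set s | sing R X k s /\ forall x, Delta R k x -> C (s x)].
Proof.
move=> cC; have -> : [set s | sing R X k s /\ forall x, Delta R k x -> C (s x)] =
    sing R X k `\` [set s | sing R X k s /\ exists2 x, Delta R k x & ~ C (s x)].
  apply/seteqP; split=> s [Xs Hs]; split=> //.
    by move=> [_ [x Dx]]; apply; exact: Hs.
  by move=> x Dx; apply: contrapT => nC; apply: Hs; split=> //; exists x.
apply: co_borelC; apply: sub_sigma_algebra; apply/co_openP.
split=> [s []//|s [Xs [x Dx nC]]].
have /nbhs_normP[e /= e0 He] : nbhs (s x) (~` C).
  by apply: open_nbhs_nbhs; split=> //; exact: closed_openC.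
by exists e => // t Xt st; split=> //; exists x => //; apply: He; exact: st.
Qed.

Lemma face_inj_sum k i (x : 'rV[R]_k.+1) (j : 'I_k.+1) :
  face R k i x ord0 (lift i j) = x ord0 j.
Proof.
rewrite mxE /= /bump; case: (leqP i j) => ij; rewrite /= ?add1n ?add0n.
  have h1 : (j.+1 < i)%N = false by lia.
  have h2 : (j.+1 == i) = false by lia.
  by rewrite h1 h2 inord_val.
by rewrite ij inord_val.
Qed.

Lemma face_self k i (x : 'rV[R]_k.+1) : face R k i x ord0 i = 0.
Proof. by rewrite mxE ltnn eqxx. Qed.

Lemma face_Delta k i (x : 'rV[R]_k.+1) :
  Delta R k.+1 (face R k i x) <-> Delta R k x.
Proof.
have S : \sum_(j < k.+2) face R k i x ord0 j = \sum_(j < k.+1) x ord0 j.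
  rewrite (bigD1_ord i) //= face_self add0r.
  by apply: eq_bigr => j _; rewrite face_inj_sum.
split=> -[h1 h2].
  by split=> [j|]; [rewrite -(face_inj_sum i x j)|rewrite -S].
split=> [j|]; last by rewrite S.
by case: (unliftP i j) => [j' ->|->]; rewrite ?face_inj_sum ?face_self.
Qed.

Lemma face_dist k i (x y : 'rV[R]_k.+1) :
  `|face R k i x - face R k i y| <= `|x - y|.
Proof.
apply: rV_norm_le => // j; rewrite [X in `|X|]mxE [X in _ + X]mxE.
case: (unliftP i j) => [j' ->|->]; rewrite ?face_inj_sum ?face_self.
  by have := rV_coord_le (x - y) j'; rewrite !mxE.
by rewrite subrr normr0.
Qed.

Lemma equicont_face k (F : set (simp k.+1)) : equicont F ->
  equicont [set s \o face R k i | s in F & i in [set: 'I_k.+2]].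
Proof.
move=> eF e e0; have [d d0 Hd] := eF e e0; exists d => // _ [s Fs [i _ <-]].
move=> x y Dx Dy xy /=; apply: Hd; rewrite ?face_Delta //.
exact: le_lt_trans (face_dist i x y) xy.
Qed.

Lemma sing_face X k i (s : simp k.+1) : sing R X k.+1 s ->
  sing R X k (s \o face R k i).
Proof.
move=> Xs; split; last split.
- apply/within_continuousP => x Dx e e0.
  have [d d0 Hd] := sing_equicont Xs e0; exists d => // y Dy xy.
  apply: Hd; rewrite ?face_Delta //; exact: le_lt_trans (face_dist i x y) xy.
- by move=> _ [x Dx <-]; apply: (sing_in Xs); rewrite face_Delta.
- by move=> x nDx; case: Xs => _ [_]; apply; rewrite face_Delta.
Qed.

Lemma co_borel_face X k i (A : set (simp k)) : co_borel R X k A ->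
  co_borel R X k.+1 [set s | sing R X k.+1 s /\ A (s \o face R k i)].
Proof.
move=> bA.
apply: (@co_borel_preimage_continuous X k.+1 k _ (fun s => s \o face R k i)) bA.
- exact: co_borel_sing.
- by move=> s; exact: sing_face.
- move=> s Xs e e0; exists e => // t Xt st x Dx /=.
  by apply: st; rewrite face_Delta.
Qed.

(** The cosimplicial identity. *)
Lemma face_face k (i : 'I_k.+3) (j : 'I_k.+2) (x : 'rV[R]_k.+1) : (j < i)%N ->
  face R k.+1 i (face R k j x) =
  face R k.+1 (widen_ord (leqnSn _) j) (face R k (inord i.-1) x).
Proof.
move=> ji; apply/rowP => l; rewrite !mxE.
have i0 : (0 < i)%N by exact: leq_ltn_trans ji.
have ik : (i.-1 < k.+2)%N by rewrite prednK // -ltnS.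
have lk := ltn_ord l.
have jk := ltn_ord j.
rewrite /= (inordK ik).
case: (ltngtP l j) => lj.
- have h1 : (l < i)%N by lia.
  have h2 : (l < i.-1)%N by lia.
  have -> : @inord k.+1 l = l :> nat by rewrite inordK //; lia.
  by rewrite h1 lj h2.
- have lp : (l.-1 < k.+2)%N by lia.
  rewrite (inordK lp); case: (ltngtP l i) => li.
  + have h1 : (l < j)%N = false by lia.
    have h2 : (l == j :> nat) = false by lia.
    have h3 : (l.-1 < i.-1)%N by lia.
    have -> : @inord k.+1 l = l :> nat by rewrite inordK //; lia.
    by rewrite h1 h2 h3.
  + have h1 : (l.-1 < j)%N = false by lia.
    have h2 : (l.-1 == j) = false by lia.
    have h3 : (l.-1 < i.-1)%N = false by lia.
    have h4 : (l.-1 == i.-1) = false by lia.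
    by rewrite h1 h2 h3 h4.
  + by rewrite li ltnn eqxx.
- by rewrite lj ji inordK // ltnn eqxx.
Qed.

(** The term at (i, j) with j < i cancels against the one at (j, i-1), which has the opposite sign.
    Natural indices keep the shift free of casts. *)
Lemma alternating_double_sum n (f : nat -> nat -> R) :
  (forall i j, (j < i <= n)%N -> f i j = f j i.-1) ->
  \sum_(i < n.+1) \sum_(j < n) (-1) ^+ i * ((-1) ^+ j * f i j) = 0.
Proof.
case: n => [|n] ff; first by rewrite big1 // => i _; rewrite big_ord0.
rewrite pair_big /= (bigID (fun p : 'I_n.+2 * 'I_n.+1 => (p.2 < p.1)%N)) /= addrC.
pose g (q : 'I_n.+2 * 'I_n.+1) : 'I_n.+2 * 'I_n.+1 := (inord q.2, inord q.1.-1).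
pose h (q : 'I_n.+2 * 'I_n.+1) : 'I_n.+2 * 'I_n.+1 := (inord q.2.+1, inord q.1).
rewrite (reindex_onto g h) /=; last first.
  move=> [i j] /=; rewrite -leqNgt => ij; rewrite /g /h /=.
  have jn := ltn_ord j.
  by congr pair; apply/val_inj; rewrite /= !inordK ?inordK //; lia.
rewrite [X in X + _](eq_bigl (fun p : 'I_n.+2 * 'I_n.+1 => (p.2 < p.1)%N)); last first.
  move=> [i j]; have jn := ltn_ord j; have jn' := ltn_ord i.
  rewrite /g /h /= (inordK (leqW jn)).
  have h1 : (i.-1 < n.+1)%N by lia.
  rewrite (inordK h1) -leqNgt.
  apply/idP/idP => [/andP[ij /eqP[]]|ij].
    move=> /(congr1 val); rewrite /= inordK; last by lia.
    by move=> ii _; lia.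
  apply/andP; split; first by lia.
  by apply/eqP; congr pair; apply/val_inj; rewrite /= inordK //; lia.
rewrite -big_split /= big1 // => -[i j] /= ji.
have jn := ltn_ord j; have jn' := ltn_ord i.
have h1 : (i.-1 < n.+1)%N by lia.
have h2 : (j < i <= n.+1)%N by lia.
rewrite (inordK h1) (inordK (leqW jn)) (ff i j h2).
have -> : i = i.-1.+1 :> nat by lia.
by rewrite /= exprS; ring.
Qed.
End BorelSets.

(** * Measures with compact carrier *)

Section Chains.
Context {R : realType}.
Implicit Types (X : set (R * R)) (k : nat).
Local Notation simp k := ('rV[R]_k.+1 -> R * R).

Lemma co_compact0 X k : co_compact R X k set0.
Proof.
split=> // I O _ _; have f0 (j : 'I_0) : I by case: j.
by exists 0%N, f0.
Qed.

Lemma co_compactU X k K L :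
  co_compact R X k K -> co_compact R X k L -> co_compact R X k (K `|` L).
Proof.
move=> [KX cK] [LX cL]; split=> [s [/KX|/LX] //|I O oO KLO].
have [|n [f Kf]] := cK I O oO; first by move=> s Ks; apply: KLO; left.
have [|m [g Lg]] := cL I O oO; first by move=> s Ls; apply: KLO; right.
exists (n + m)%N, (fun j => match fintype.split j with inl i => f i | inr i => g i end).
move=> s [/Kf[j _ Os]|/Lg[j _ Os]].
  by exists (lshift m j) => //; rewrite -[lshift m j]/(fintype.unsplit (inl j)) unsplitK.
by exists (rshift n j) => //; rewrite -[rshift n j]/(fintype.unsplit (inr j)) unsplitK.
Qed.

Definition sigma_additive X k (mu : set (simp k) -> R) :=
  forall F : nat -> set (simp k),
    (forall n, co_borel R X k (F n)) -> trivIset setT F ->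
    (fun n => \sum_(i < n) mu (F i)) @ \oo --> mu (\bigcup_n F n).

Definition carried X k (mu : set (simp k) -> R) (K : set (simp k)) :=
  forall B, co_borel R X k B -> B `&` K = set0 -> mu B = 0.

Lemma seq_cvg_unique (u : nat -> R) (a b : R) :
  u @ \oo --> a -> u @ \oo --> b -> a = b.
Proof. exact: norm_cvg_unique. Qed.

Section Additivity.
Variables (X : set (R * R)) (k : nat) (mu : set (simp k) -> R).
Hypothesis mu_add : sigma_additive X mu.

(** The partial sums of the constant [mu set0] converge, so their successive differences, all equal
    to [mu set0], tend to 0. *)
Lemma sigma_additive_set0 : mu set0 = 0.
Proof.
have := mu_add (fun=> @co_borel0 R X k) (@trivIset_set0 _ _ _).
rewrite bigcup0 // => h.
have h1 : (fun n => \sum_(i < n.+1) mu set0) @ \oo --> mu set0.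
  by rewrite (cvg_shiftS (fun n => \sum_(i < n) mu set0)).
have h2 : (fun=> mu set0) @ \oo --> mu set0 - mu set0.
  have -> : (fun=> mu set0) =
      (fun n => \sum_(i < n.+1) mu set0 - \sum_(i < n) mu set0).
    by apply/funext => n /=; rewrite big_ord_recr /= addrAC subrr add0r.
  exact: cvgB h1 h.
by rewrite -(subrr (mu set0)); apply: seq_cvg_unique h2; exact: cvg_cst.
Qed.

Lemma sigma_additiveU A B : co_borel R X k A -> co_borel R X k B ->
  A `&` B = set0 -> mu (A `|` B) = mu A + mu B.
Proof.
move=> bA bB AB; pose F n := if n == 0%N then A else if n == 1%N then B else set0.
have bF n : co_borel R X k (F n).
  by rewrite /F; case: ifP => // _; case: ifP => // _; exact: co_borel0.
have tF : trivIset setT F.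
  apply/trivIsetP => -[|[|i]] [|[|j]] _ _ //= _;
    by rewrite /F /= ?setI0 ?set0I // setIC.
have := mu_add bF tF.
have -> : \bigcup_n F n = A `|` B.
  apply/seteqP; split=> [s [[|[|n]] _ //= Fs]|s [As|Bs]]; [by left|by right| |].
    by exists 0%N.
  by exists 1%N.
move=> h; have : (fun n => \sum_(i < n.+2) mu (F i)) @ \oo --> mu (A `|` B).
  rewrite (cvg_shiftS (fun n => \sum_(i < n.+1) mu (F i))).
  by rewrite (cvg_shiftS (fun n => \sum_(i < n) mu (F i))).
have -> : (fun n => \sum_(i < n.+2) mu (F i)) = fun=> mu A + mu B.
  apply/funext => n; rewrite !big_ord_recl /= big1 ?addr0 // => i _.
  exact: sigma_additive_set0.
by move=> h2; apply: seq_cvg_unique h2 _; exact: cvg_cst.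
Qed.

Lemma sigma_additiveID A B : co_borel R X k A -> co_borel R X k B ->
  mu A = mu (A `&` B) + mu (A `\` B).
Proof.
move=> bA bB; rewrite -sigma_additiveU ?setUIDK //.
- exact: co_borelI.
- exact: co_borelD.
- by rewrite setIDA setIAC -setIDA setDv setI0.
Qed.

(** Allows sets to be compared on the carrier alone, where the oscillation bound on lifts is
    available. *)
Lemma carried_eq K A B : carried X mu K ->
  co_borel R X k A -> co_borel R X k B ->
  (forall s, K s -> A s <-> B s) -> mu A = mu B.
Proof.
move=> cK bA bB AB.
rewrite (sigma_additiveID bA bB) (sigma_additiveID bB bA) setIC.
rewrite (cK (A `\` B)) ?(cK (B `\` A)) //; try exact: co_borelD;
  by rewrite -subset0 => s [[? ?] /AB]; tauto.
Qed.

(** Reduces the vanishing of a signed sum to the single pieces of countable partitions; the pieces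
    will be cut out by the block index. *)
Lemma sigma_additive_sum_eq0 (I : finType) (c : I -> R) (A : I -> nat -> set (simp k)) :
  (forall i m, co_borel R X k (A i m)) -> (forall i, trivIset setT (A i)) ->
  (forall m, \sum_i c i * mu (A i m) = 0) ->
  \sum_i c i * mu (\bigcup_m A i m) = 0.
Proof.
move=> bA tA s0.
have h : (fun N => \sum_i c i * \sum_(m < N) mu (A i m)) @ \oo -->
    \sum_i c i * mu (\bigcup_m A i m).
  apply: cvg_big => [|i _]; first exact: add_continuous.
  by apply: cvgM; [exact: cvg_cst|exact: mu_add].
apply: seq_cvg_unique h _.
under eq_fun => N.
  under eq_bigr do rewrite mulr_sumr.
  rewrite exchange_big big1 /=; last by move=> m _; exact: s0.
  over.
exact: cvg_cst.
Qed.
End Additivity.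

Lemma mt_chainP X k mu : mt_chain R X k mu <->
  sigma_additive X mu /\ exists2 K, co_compact R X k K & carried X mu K.
Proof.
by split=> -[h [K]]; [move=> [cK mK]|move=> cK mK]; split=> //; exists K.
Qed.

(** The pushforward of [mu] restricted to [E]. Continuity of [f] is not assumed, so the image of [K]
    may fail to be compact and a compact [L] around it is supplied separately. *)
Lemma mt_chain_push X k l (mu : set (simp k) -> R) (E K : set (simp k))
    (L : set (simp l)) (f : simp k -> simp l) :
  sigma_additive X mu -> carried X mu K -> co_compact R X l L ->
  (forall A, co_borel R X l A -> co_borel R X k (E `&` f @^-1` A)) ->
  (forall s, K s -> E s -> L (f s)) ->
  mt_chain R X l (fun A => mu (E `&` f @^-1` A)).
Proof.
move=> am cK cL bf KL; apply/mt_chainP; split.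
  move=> F bF tF; rewrite preimage_bigcup setI_bigcupr; apply: am => [n|].
    exact: bf.
  apply/trivIsetP => i j _ _ ij; move/trivIsetP: tF => /(_ i j I I ij) F0.
  by rewrite setIACA -preimage_setI F0 preimage_set0 setI0.
exists L => // B bB BL; apply: cK; first exact: bf.
rewrite -subset0 => s [[Es Bs] Ks].
have : (B `&` L) (f s) by split=> //; exact: KL.
by rewrite BL.
Qed.

Lemma mt_chain0 X k : mt_chain R X k (fun=> 0).
Proof.
apply/mt_chainP; split; last by exists set0 => //; exact: co_compact0.
by move=> F _ _; under eq_fun do rewrite big1 //; exact: cvg_cst.
Qed.

Lemma mt_chainD X k mu nu : mt_chain R X k mu -> mt_chain R X k nu ->
  mt_chain R X k (fun A => mu A + nu A).
Proof.
move=> /mt_chainP[am [K cK mK]] /mt_chainP[an [L cL nL]]; apply/mt_chainP; split.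
  move=> F bF tF; under eq_fun do rewrite big_split /=.
  by apply: cvgD; [exact: am|exact: an].
exists (K `|` L); first exact: co_compactU.
move=> B bB; rewrite setIUr setU_eq0 => -[BK BL].
by rewrite mK // nL // addr0.
Qed.

Lemma mt_chainZ X k c mu : mt_chain R X k mu ->
  mt_chain R X k (fun A => c * mu A).
Proof.
move=> /mt_chainP[am [K cK mK]]; apply/mt_chainP; split.
  move=> F bF tF; under eq_fun do rewrite -mulr_sumr.
  by apply: cvgM; [exact: cvg_cst|exact: am].
by exists K => // B bB BK; rewrite mK // mulr0.
Qed.

Lemma mt_chain_sum X k n (mu : 'I_n -> set (simp k) -> R) :
  (forall i, mt_chain R X k (mu i)) ->
  mt_chain R X k (fun A => \sum_(i < n) mu i A).
Proof.
elim: n mu => [|n IH] mu cmu.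
  by under eq_fun do rewrite big_ord0; exact: mt_chain0.
under eq_fun do rewrite big_ord_recl.
by apply: mt_chainD; [exact: cmu|apply: IH].
Qed.
End Chains.

(** * Unrolling the Warsaw circle *)

Section Unrolling.
Context {R : realType}.
Local Notation simp k := ('rV[R]_k.+1 -> R * R).

Lemma pair_norm_lt (p : R * R) e : (`|p| < e) = (`|p.1| < e) && (`|p.2| < e).
Proof. by rewrite [`|p|]/Num.norm /= gt_max. Qed.

Lemma pair_norm1 (p : R * R) : `|p.1| <= `|p|.
Proof. by rewrite [`|p|]/Num.norm /= le_max lexx. Qed.

Lemma pair_norm2 (p : R * R) : `|p.2| <= `|p|.
Proof. by rewrite [`|p|]/Num.norm /= le_max lexx orbT. Qed.

Lemma sin_dist (a b : R) : `|sin a - sin b| <= `|a - b|.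
Proof.
wlog ab : a b / a <= b.
  by move=> h; case: (leP a b) => [/h //|/ltW/h]; rewrite distrC (distrC b).
have [->|nab] := eqVneq a b; first by rewrite !subrr normr0.
have {nab}ab : a < b by rewrite lt_neqAle nab.
have [|c _ E] := @MVT R sin cos a b ab (fun x _ => is_derive_sin x).
  by apply: continuous_subspaceT => x; exact: continuous_sin.
rewrite distrC E normrM (distrC a).
by rewrite ler_piMl // cos_max.
Qed.

(** Sample the sine at m-k, m, m+k: the second difference controls [sin m], the difference of the
    outer values controls [cos m], and both cannot be below 1/2 in absolute value since their
    squares sum to 1. *)
Lemma sin_oscillation (e : R) : 0 < e -> exists2 d : R, 0 < d &
  forall a b, a <= b ->
    (forall s t, a <= s <= b -> a <= t <= b -> `|sin s - sin t| < d) ->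
    b - a <= e.
Proof.
(* k <= e/2 fits a, a+k, a+2k into an interval longer than e; k <= 1/2 is below pi/2, so sin k and 1
   - cos k are positive. *)
move=> e0; pose k := Num.min e 1 / 2.
have ke : k <= e / 2 by rewrite ler_pM2r // ge_min lexx.
have k1 : k <= 1 / 2 by rewrite ler_pM2r // ge_min lexx orbT.
have k0 : 0 < k by rewrite divr_gt0 // lt_min e0 /=.
have h := @pihalf_ge1 R.
have sk : 0 < sin k by apply: sin_gt0_pihalf; lra.
have ck : cos k < 1.
  by rewrite -(@cos0 R) ltr_cos ?in_itv /=; lra.
pose d := Num.min (1 - cos k) (sin k) / 2.
have d0 : 0 < d by rewrite divr_gt0 // lt_min sk subr_gt0 ck.
have dc : d <= (1 - cos k) / 2 by rewrite ler_pM2r // ge_min lexx.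
have ds : d <= sin k / 2 by rewrite ler_pM2r // ge_min lexx orbT.
exists d => // a b ab osc; rewrite leNgt; apply/negP => eab.
pose m := a + k.
have h1 : `|sin m - sin (m - k)| < d by apply: osc; rewrite /m; lra.
have h2 : `|sin m - sin (m + k)| < d by apply: osc; rewrite /m; lra.
have h3 : `|sin (m + k) - sin (m - k)| < d by apply: osc; rewrite /m; lra.
have s1 : `|sin m| * (1 - cos k) < d.
  rewrite -[X in _ * X]ger0_norm ?subr_ge0 ?cos_le1 // -normrM.
  have -> : sin m * (1 - cos k) =
      ((sin m - sin (m - k)) + (sin m - sin (m + k))) / 2.
    by rewrite !sinD sinN cosN; field.
  rewrite normrM [`|2^-1|]gtr0_norm ?invr_gt0 // ltr_pdivrMr //.
  by rewrite (le_lt_trans (ler_normD _ _)) //; lra.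
have s2 : `|cos m| * sin k < d / 2.
  rewrite -[X in _ * X](gtr0_norm sk) -normrM.
  have -> : cos m * sin k = (sin (m + k) - sin (m - k)) / 2.
    by rewrite !sinD sinN cosN; field.
  by rewrite normrM [`|2^-1|]gtr0_norm ?invr_gt0 // ltr_pM2r.
have t1 : `|sin m| < 1 / 2.
  rewrite -(@ltr_pM2r _ (1 - cos k)) ?subr_gt0 //; lra.
have t2 : `|cos m| < 1 / 2.
  rewrite -(@ltr_pM2r _ (sin k)) //; lra.
have := cos2Dsin2 m; rewrite -(real_normK (num_real (cos m))) -(real_normK (num_real (sin m))).
have := normr_ge0 (sin m); have := normr_ge0 (cos m).
by nra.
Qed.

Section Curve.
Variable gamma : R -> R * R.
Hypothesis Hg : warsaw_arc R gamma.

Let q : R := 3 * pi / 2.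

Let q1 : 1 < q.
Proof. by have := @pi_ge2 R; rewrite /q; lra. Qed.

Let xminE : x_min R = q^-1.
Proof. by rewrite /x_min /q invf_div. Qed.

Let sinq : sin q = -1.
Proof.
have -> : q = pi / 2 + pi by rewrite /q; field.
by rewrite sinDpi sin_pihalf.
Qed.

(** The value of 1/x along the sine curve, frozen at 1/x_min up to parameter 3. Inversion is
    1-Lipschitz on its range, which lies above 1. *)
Let theta (u : R) := Num.max 0 (u - 3) + q.

Let theta1 u : 1 < theta u.
Proof.
have h : 0 <= Num.max 0 (u - 3) by rewrite le_max lexx.
by rewrite /theta; have := q1; lra.
Qed.

(* The continuous bijection from the half line [0, +oo[ onto the Warsaw circle:
   down the segment, along the arc, then along the sine curve towards x = 0.
   Each summand is constant off its own range of parameters. *)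
Definition unroll (u : R) : R * R :=
  (0, 1 - Num.min u 2) +
  (gamma (Num.max 0 (Num.min 1 (u - 2))) - (0, -1)) +
  (((theta u)^-1, sin (theta u)) - (x_min R, -1)).

Lemma pairP (a b : R * R) : a.1 = b.1 -> a.2 = b.2 -> a = b.
Proof. by case: a b => [? ?] [? ?] /= -> ->. Qed.

Lemma unroll_seg u : u <= 2 -> unroll u = (0, 1 - u).
Proof.
move=> u2; have [_ [_ [g0 _]]] := Hg.
rewrite /unroll (min_idPl u2).
have -> : Num.max 0 (Num.min 1 (u - 2)) = 0.
  by apply/max_idPl; rewrite ge_min; apply/orP; right; lra.
have -> : theta u = q by rewrite /theta (max_idPl _) ?add0r //; lra.
by rewrite g0 sinq xminE !subrr !addr0.
Qed.

Lemma unroll_arc u : 2 <= u <= 3 -> unroll u = gamma (u - 2).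
Proof.
move=> /andP[u2 u3]; rewrite /unroll (min_idPr u2).
have -> : Num.max 0 (Num.min 1 (u - 2)) = u - 2.
  rewrite (min_idPr _) ?(max_idPr _) //; lra.
have -> : theta u = q by rewrite /theta (max_idPl _) ?add0r //; lra.
rewrite sinq xminE subrr addr0; apply: pairP => /=; lra.
Qed.

Lemma unroll_sine u : 3 <= u -> unroll u = ((u - 3 + q)^-1, sin (u - 3 + q)).
Proof.
move=> u3; have [_ [_ [_ [g1 _]]]] := Hg.
rewrite /unroll (min_idPr _); last lra.
have -> : Num.max 0 (Num.min 1 (u - 2)) = 1.
  rewrite (min_idPl _) ?(max_idPr _) //; lra.
have -> : theta u = u - 3 + q by rewrite /theta (max_idPr _) //; lra.
by rewrite g1; apply: pairP => /=; lra.
Qed.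

(** Each summand is uniformly continuous on the whole line: clamping is 1-Lipschitz, [gamma] is
    uniformly continuous on [0, 1], and so are sine and, beyond 1, inversion. *)
Lemma unroll_uniform e : 0 < e -> exists2 d : R, 0 < d &
  forall u v, `|u - v| < d -> `|unroll u - unroll v| < e.
Proof.
move=> e0; have [cg _] := Hg.
have e30 : 0 < e / 3 by lra.
have [d d0 Hd] := compact_within_uniform (@segment_compact R 0 1) cg e30.
have max_dist (a u v : R) : `|Num.max a u - Num.max a v| <= `|u - v|.
  have h1 := ler_norm (u - v); have h2 : v - u <= `|u - v| by rewrite distrC ler_norm.
  have h3 := normr_ge0 (u - v).
  case: (leP a u); case: (leP a v) => av au; rewrite ler_norml; lra.
have min_dist (a u v : R) : `|Num.min a u - Num.min a v| <= `|u - v|.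
  have h1 := ler_norm (u - v); have h2 : v - u <= `|u - v| by rewrite distrC ler_norm.
  have h3 := normr_ge0 (u - v).
  case: (leP a u); case: (leP a v) => av au; rewrite ler_norml; lra.
exists (Num.min d (e / 3)) => [|u v]; first by rewrite lt_min d0.
rewrite lt_min => /andP[uvd uve].
have tt : `|theta u - theta v| < e / 3.
  rewrite /theta (_ : _ - _ = Num.max 0 (u - 3) - Num.max 0 (v - 3)); last by ring.
  rewrite (le_lt_trans (max_dist _ _ _)) //.
  by rewrite opprB addrA subrK.
have hs : `|((0, 1 - Num.min u 2) : R * R) - (0, 1 - Num.min v 2)| < e / 3.
  rewrite pair_norm_lt /= subrr normr0 e30 /= (_ : 1 - _ - _ = Num.min 2 v - Num.min 2 u).
    by rewrite (le_lt_trans (min_dist _ _ _)) // distrC.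
  by rewrite !(minC 2); ring.
have hg : `|gamma (Num.max 0 (Num.min 1 (u - 2))) - (0, -1) -
           (gamma (Num.max 0 (Num.min 1 (v - 2))) - (0, -1))| < e / 3.
  rewrite opprB addrA subrK; apply: Hd => /=.
  - by rewrite in_itv /= le_max lexx /= ge_max ler01 ge_min lexx.
  - by rewrite in_itv /= le_max lexx /= ge_max ler01 ge_min lexx.
  - rewrite (le_lt_trans (max_dist _ _ _)) // (le_lt_trans (min_dist _ _ _)) //.
    by rewrite opprB addrA subrK.
have hc : `|((theta u)^-1, sin (theta u)) - (x_min R, -1) -
           (((theta v)^-1, sin (theta v)) - (x_min R, -1))| < e / 3.
  rewrite opprB addrA subrK pair_norm_lt /=; apply/andP; split; last first.
    by rewrite (le_lt_trans (sin_dist _ _)).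
  have tu := theta1 u; have tv := theta1 v.
  have -> : (theta u)^-1 - (theta v)^-1 = (theta v - theta u) / (theta u * theta v).
    by field; apply/andP; split; apply: lt0r_neq0; lra.
  have h : 1 <= theta u * theta v by nra.
  rewrite normrM distrC (le_lt_trans _ tt) // ler_piMr // gtr0_norm ?invr_gt0; last lra.
  by rewrite invf_le1 //; lra.
have split3 (a b c a' b' c' : R * R) :
    a + b + c - (a' + b' + c') = (a - a') + (b - b') + (c - c').
  by rewrite opprD addrACA opprD; congr (_ + _); rewrite addrACA.
rewrite /unroll split3.
apply: (le_lt_trans (ler_normD _ _)).
apply: (le_lt_trans (lerD (ler_normD _ _) (lexx _))); lra.
Qed.

(** Different pieces are separated by the disjointness clause of [warsaw_arc], or by the first
    coordinate, which is positive on the sine curve and 0 on the segment. *)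
Lemma unroll_inj u v : 0 <= u -> 0 <= v -> unroll u = unroll v -> u = v.
Proof.
wlog uv : u v / u <= v.
  move=> h u0 v0 E; case: (leP u v) => [|/ltW] vu; first exact: h.
  by apply/esym; exact: h.
move=> u0 v0; have [_ [gi [g0 [g1 gW]]]] := Hg.
have q_gt1 := q1.
have inv_gt0 w : 3 <= w -> 0 < (w - 3 + q)^-1 by move=> w3; rewrite invr_gt0; lra.
case: (leP u 2) => u2.
  rewrite unroll_seg //; case: (leP v 2) => v2.
    by rewrite unroll_seg // => -[]; lra.
  case: (leP v 3) => v3.
    rewrite unroll_arc ?(ltW v2) // => E.
    have [] := gW (v - 2); first by rewrite in_itv /=; lra.
    - by rewrite -E; right; split=> //=; lra.
    - by move=> v20; move: E; rewrite v20 g0 => -[]; lra.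
    - move=> v21; move: E; rewrite v21 g1 => -[E _].
      by have := inv_gt0 3; rewrite subrr add0r -xminE -E ltxx => /(_ (lexx _)).
  rewrite unroll_sine ?(ltW v3) // => -[E _].
  by have := inv_gt0 v (ltW v3); rewrite -E ltxx.
case: (leP v 3) => v3.
  rewrite !unroll_arc ?v3 ?andbT; try lra.
  move=> /gi; rewrite !inE /= !in_itv /= => h.
  have : u - 2 = v - 2 by apply: h; lra.
  by lra.
case: (leP u 3) => u3.
  rewrite unroll_arc ?(ltW u2) // unroll_sine ?(ltW v3) // => E.
  have [] := gW (u - 2); first by rewrite in_itv /=; lra.
  - left; rewrite E; split; [|split] => /=; last by rewrite invrK.
      exact: inv_gt0 (ltW v3).
    by rewrite xminE lef_pV2 ?posrE; lra.
  - by move=> u20; exfalso; lra.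
  - move=> u21; move: E; rewrite u21 g1 => -[E _].
    move: E; rewrite xminE => /invr_inj E; exfalso; lra.
by rewrite !unroll_sine ?(ltW v3) ?(ltW u3) // => -[/invr_inj E _]; lra.
Qed.

Local Notation W := (warsaw R gamma).

Lemma unroll_in u : 0 <= u -> W (unroll u).
Proof.
move=> u0; have q_gt1 := q1; case: (leP u 2) => u2.
  by rewrite unroll_seg //; left; right; split=> //=; lra.
case: (leP u 3) => u3.
  rewrite unroll_arc ?(ltW u2) //; right; exists (u - 2) => //=.
  by rewrite in_itv /=; lra.
rewrite unroll_sine ?(ltW u3) //; left; left; split=> /=.
  by rewrite invr_gt0; lra.
by rewrite invrK; split=> //; rewrite xminE lef_pV2 ?posrE; lra.
Qed.

Lemma sine_unroll p : sine_part R p -> exists2 u, 3 <= u & unroll u = p.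
Proof.
move=> [p0 [px py]]; exists (p.1^-1 + 3 - q).
  have : q <= p.1^-1 by rewrite -(invrK q) lef_pV2 ?posrE ?invr_gt0 -?xminE //; have := q1; lra.
  by lra.
have pq : q <= p.1^-1.
  by rewrite -[leLHS]invrK lef_pV2 ?posrE ?invr_gt0 -?xminE //; have := q1; lra.
rewrite unroll_sine; last lra.
by rewrite (_ : _ - 3 + q = p.1^-1) ?invrK -?py -?surjective_pairing //; ring.
Qed.

Lemma seg_unroll p : seg_part R p -> exists2 u, 0 <= u <= 2 & unroll u = p.
Proof.
move=> [p0 p1]; exists (1 - p.2); first lra.
by rewrite unroll_seg; [apply: pairP => /=; rewrite ?p0 //; ring|lra].
Qed.

Lemma warsaw_unroll p : W p -> exists2 u, 0 <= u & unroll u = p.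
Proof.
case=> [[/sine_unroll[u u3 <-]|/seg_unroll[u u2 <-]]|[t /=]].
- by exists u => //; lra.
- by exists u => //; lra.
rewrite in_itv /= => t01 <-; exists (t + 2); first lra.
by rewrite unroll_arc ?addrK //; lra.
Qed.

(** The inverse of [unroll] on the circle, with default 0 elsewhere. It jumps at the segment, where
    the sine curve accumulates, so lifts are controlled along paths. *)
Definition height (p : R * R) : R := xget 0 [set u | 0 <= u /\ unroll u = p].

Lemma unrollK u : 0 <= u -> height (unroll u) = u.
Proof.
move=> u0; rewrite /height; case: xgetP => [v _ [v0 E]|/(_ u)].
  exact: unroll_inj E.
by case.
Qed.

Lemma heightK p : W p -> unroll (height p) = p.
Proof. by move=> /warsaw_unroll[u u0 <-]; rewrite unrollK. Qed.

Lemma height_ge0 p : W p -> 0 <= height p.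
Proof. by move=> /warsaw_unroll[u u0 <-]; rewrite unrollK. Qed.
End Curve.
End Unrolling.

(** * Heights along paths of small diameter *)

Section SmallPaths.
Context {R : realType}.
Local Notation simp k := ('rV[R]_k.+1 -> R * R).

Lemma closure_dist (V : normedModType R) (A : set V) p :
  closure A p <-> forall e : R, 0 < e -> exists2 x, A x & `|p - x| < e.
Proof.
split=> [cA e e0|h B /nbhs_normP[e /= e0 He]].
  have [x [Ax]] := cA (ball p e) (nbhsx_ballx _ _ e0).
  by rewrite -ball_normE; exists x.
by have [x Ax px] := h e e0; exists x; split=> //; exact: He.
Qed.

Section Paths.
Variable gamma : R -> R * R.
Hypothesis Hg : warsaw_arc R gamma.
Local Notation W := (warsaw R gamma).
Local Notation unroll := (unroll gamma).
Local Notation height := (height gamma).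

Let q : R := 3 * pi / 2.

Let q1 : 1 < q.
Proof. by have := @pi_ge2 R; rewrite /q; lra. Qed.

Lemma sine_seg_closed : closed (sine_part R `|` seg_part R).
Proof.
have xm0 : 0 < x_min R by rewrite /x_min divr_gt0 // mulr_gt0 // pi_gt0.
have TB p : (sine_part R `|` seg_part R) p ->
    [/\ 0 <= p.1, p.1 <= x_min R, -1 <= p.2 & p.2 <= 1].
  move=> [[h1 [h2 ->]]|[-> /andP[h1 h2]]]; last by split=> //; exact: ltW.
  by split; [exact: ltW|exact: h2|exact: sin_geN1|exact: sin_le1].
move=> p /closure_dist cp.
have {}cp e : 0 < e -> exists r, [/\ (sine_part R `|` seg_part R) r,
    `|p.1 - r.1| < e & `|p.2 - r.2| < e].
  move=> /cp[r Tr]; rewrite pair_norm_lt => /andP[]; by exists r.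
have x0 : 0 <= p.1.
  rewrite leNgt; apply/negP => n0; have [|r [/TB[]]] := cp (- p.1); first lra.
  by move=> ? _ _ _; rewrite ltr_norml; lra.
have x1 : p.1 <= x_min R.
  rewrite leNgt; apply/negP => n0; have [|r [/TB[]]] := cp (p.1 - x_min R); first lra.
  by move=> _ ? _ _; rewrite ltr_norml; lra.
have y0 : -1 <= p.2.
  rewrite leNgt; apply/negP => n0; have [|r [/TB[]]] := cp (-1 - p.2); first lra.
  by move=> _ _ ? _ _; rewrite ltr_norml; lra.
have y1 : p.2 <= 1.
  rewrite leNgt; apply/negP => n0; have [|r [/TB[]]] := cp (p.2 - 1); first lra.
  by move=> _ _ _ ? _; rewrite ltr_norml; lra.
have [px|px] := eqVneq p.1 0; first by right; split=> //; rewrite y0.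
have {}x0 : 0 < p.1 by rewrite lt_neqAle eq_sym px.
left; split=> //; split=> //; apply/eqP; rewrite -subr_eq0 -normr_eq0.
apply/eqP; apply: contrapT => /eqP; set z := `|_| => z0.
have {}z0 : 0 < z by rewrite lt_neqAle eq_sym z0 normr_ge0.
(* The first bound keeps r.1 above p.1/2, so the third gives a difference of at most z/4 between
   1/p.1 and 1/r.1; the second leaves z/2 for the ordinates. *)
pose e := Num.min (p.1 / 2) (Num.min (z / 2) (z * p.1 ^+ 2 / 8)).
have e0 : 0 < e by rewrite !lt_min !divr_gt0 ?mulr_gt0 ?exprn_gt0.
have e1 : e <= p.1 / 2 by rewrite ge_min lexx.
have e2 : e <= z / 2 by rewrite !ge_min lexx orbT.
have e3 : e <= z * p.1 ^+ 2 / 8 by rewrite !ge_min lexx !orbT.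
have [r [Tr r1 r2]] := cp e e0.
have rp : p.1 / 2 < r.1 by move: r1; rewrite ltr_norml; lra.
have sr : r.2 = sin r.1^-1 by case: Tr => [[_ []] //|[r10 _]]; lra.
have h : `|sin p.1^-1 - sin r.1^-1| <= z / 4.
  rewrite (le_trans (sin_dist _ _)) //.
  have -> : p.1^-1 - r.1^-1 = (r.1 - p.1) / (p.1 * r.1).
    by field; apply/andP; split; apply: lt0r_neq0; lra.
  have pr : 0 < p.1 * r.1 by rewrite mulr_gt0 //; lra.
  rewrite normrM distrC [`|_^-1|]gtr0_norm ?invr_gt0 // ler_pdivrMr //.
  rewrite (le_trans (ltW r1)) // (le_trans e3) //.
  rewrite (_ : z * p.1 ^+ 2 / 8 = z / 4 * (p.1 * (p.1 / 2))); last by field.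
  by rewrite !ler_pM2l ?divr_gt0 // ltW.
have : z < z; last by rewrite ltxx.
rewrite {1}/z -(subrKA r.2) (le_lt_trans (ler_normD _ _)) //.
by rewrite {2}sr (distrC _ (sin p.1^-1)); lra.
Qed.

Lemma warsaw_compact : compact W.
Proof.
apply: compactU; last first.
  by apply: continuous_compact (@segment_compact _ _ _); case: Hg.
apply: (subclosed_compact sine_seg_closed
  (compact_setX (@segment_compact R 0 (x_min R)) (@segment_compact R (-1) 1))).
have xm0 : 0 < x_min R by rewrite /x_min divr_gt0 // mulr_gt0 // pi_gt0.
move=> p [[h1 [h2 E]]|[E h]]; split; rewrite /= in_itv /= ?E ?h //.
- by rewrite h2 ltW.
- by rewrite sin_geN1 sin_le1.
- by rewrite lexx ltW.
Qed.

(** A continuous injection of a compact interval has a uniformly continuous inverse; compactness is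
    applied to pairs of parameters. No modulus serves all [N], as the far sine curve comes close to
    the segment. *)
Lemma unroll_inv_uniform N e : 0 < e -> exists2 d : R, 0 < d &
  forall u v, 0 <= u <= N -> 0 <= v <= N ->
    `|unroll u - unroll v| < d -> `|u - v| < e.
Proof.
move=> e0.
have cK := compact_setX (@segment_compact R 0 N) (@segment_compact R 0 N).
have [|d d0 Hd] := @compact_uniform R (R * R)%type _ (fun d p =>
    e <= `|p.1 - p.2| -> d <= `|unroll p.1 - unroll p.2|) cK.
  move=> [u v] /= [/= uN vN]; move: uN vN; rewrite !in_itv /= => /andP[u0 _] /andP[v0 _].
  case: (ltP `|u - v| e) => uve.
    exists ((e - `|u - v|) / 2) => [|d [u' v'] _]; first lra.
    rewrite pair_norm_lt /= => /andP[uu vv] le; exfalso.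
    have := ler_distD u u' v'; have := ler_distD v u v'.
    by rewrite (distrC u' u); lra.
  pose r := `|unroll u - unroll v|.
  have r0 : 0 < r.
    rewrite normr_gt0 subr_eq0; apply/eqP => /(unroll_inj Hg u0 v0) uv.
    by move: uve; rewrite uv subrr normr0; lra.
  have [|d d0 Hd] := unroll_uniform Hg (_ : 0 < r / 4); first lra.
  exists (Num.min d (r / 2)) => [|d' [u' v']].
    by rewrite lt_min d0; lra.
  rewrite lt_min => /andP[_ /andP[_ d'r]].
  rewrite pair_norm_lt /= !lt_min => /andP[/andP[/Hd uu _] /andP[/Hd vv _]] _.
  have := ler_distD (unroll u') (unroll u) (unroll v).
  have := ler_distD (unroll v') (unroll u') (unroll v).
  by rewrite -/r (distrC (unroll v')); lra.
exists d => // u v uN vN uvd; rewrite ltNge; apply/negP => uve.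
have : d <= `|unroll u - unroll v|.
  by apply: (Hd (u, v)) uve; split; rewrite /= in_itv.
by rewrite leNgt uvd.
Qed.

(** The segment together with the arc; [unroll 3] is its only point on the sine curve. *)
Let A := unroll @` [set u | 0 <= u <= 3].

Let A_closed : closed A.
Proof.
apply: compact_closed; first exact: norm_hausdorff.
rewrite /A (_ : [set u | 0 <= u <= 3] = `[0, 3]%classic); last first.
  by apply/seteqP; split=> u /=; rewrite in_itv.
apply: continuous_compact (@segment_compact _ _ _).
apply/within_continuousP => u _ e e0.
by have [d d0 Hd] := unroll_uniform Hg e0; exists d => // v _; exact: Hd.
Qed.

Let notA_sine p : W p -> ~ A p -> sine_part R p.
Proof.
move=> Wp nA; have [u u0 E] := warsaw_unroll Hg Wp; subst p.
have u3 : 3 < u by rewrite ltNge; apply/negP => u3; apply: nA; exists u => //=; rewrite u0.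
rewrite unroll_sine ?(ltW u3) //; split=> /=; first by rewrite invr_gt0; have := q1; rewrite /q; lra.
have -> : x_min R = q^-1 by rewrite /x_min /q invf_div.
by rewrite invrK; split=> //; rewrite lef_pV2 ?posrE; have := q1; rewrite /q; lra.
Qed.

Let height_sine p : sine_part R p -> height p = p.1^-1 + 3 - q.
Proof.
move=> /(sine_unroll Hg)[u u3 <-]; rewrite (unrollK Hg) //; last lra.
by rewrite unroll_sine //= invrK /q; ring.
Qed.

Definition small_path (d : R) (c : R -> R * R) :=
  [/\ {within `[0, 1], continuous c}, (forall t, 0 <= t <= 1 -> W (c t)) &
   forall s t, 0 <= s <= 1 -> 0 <= t <= 1 -> `|c s - c t| < d].

Lemma small_path_sub d c a b : small_path d c -> 0 <= a <= 1 -> 0 <= b <= 1 ->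
  small_path d (fun r => c (a + r * (b - a))).
Proof.
move=> [/within_continuousP cc Wc dc] a01 b01.
have ab r : 0 <= r <= 1 -> 0 <= a + r * (b - a) <= 1 by nra.
split=> [|t /ab/Wc //|s t /ab sa /ab ta]; last exact: dc.
apply/within_continuousP => r; rewrite /= in_itv /= => /ab r01 e e0.
have [|d' d'0 Hd'] := cc (a + r * (b - a)) _ e e0; first by rewrite /= in_itv.
exists d' => // y; rewrite /= in_itv /= => /ab y01 ry; apply: Hd'.
  by rewrite /= in_itv.
rewrite opprD addrACA subrr add0r -mulrBl normrM (le_lt_trans _ ry) //.
by rewrite ler_piMr // ler_norml; lra.
Qed.

(** On the sine curve the height is 1/x up to a constant, and y = sin (1/x). By the intermediate
    value theorem 1/x sweeps the interval between its end values, so [sin_oscillation] bounds the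
    length of that interval by the range of y. *)
Lemma sine_path_small e : 0 < e -> exists2 d : R, 0 < d & forall c,
  small_path d c -> (forall t, 0 <= t <= 1 -> sine_part R (c t)) ->
  `|height (c 0) - height (c 1)| <= e.
Proof.
move=> e0; have [d d0 Hd] := sin_oscillation e0; exists d => // c [cc Wc dc] sc.
rewrite !height_sine; try by apply: sc; lra.
set a := (c 0).1^-1; set b := (c 1).1^-1.
rewrite (_ : _ - _ = a - b); last by rewrite /a /b; ring.
pose v t := (c t).1^-1.
have vc : {within `[0, 1], continuous v}.
  apply/subspace_continuousP => t t01.
  have h : (c s).1 @[s --> within `[0, 1] (nbhs t)] --> (c t).1.
    apply: (@cvg_comp _ _ _ c fst _ (nbhs (c t))); last exact: cvg_fst.
    by move/subspace_continuousP: cc; apply.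
  have c0 : (c t).1 != 0.
    by apply: lt0r_neq0; case: (sc t) => //; move: t01; rewrite /= in_itv.
  exact: cvgV c0 h.
have ivt w : Num.min a b <= w <= Num.max a b ->
    exists2 t, 0 <= t <= 1 & w = v t.
  move=> /(IVT ler01 vc)[t]; rewrite in_itv /= => t01 <-; by exists t.
rewrite (_ : `|a - b| = Num.max a b - Num.min a b); last first.
  case: (leP a b) => ab; last by rewrite gtr0_norm ?subr_gt0.
  by rewrite distrC ger0_norm ?subr_ge0.
apply: Hd; first by case: (leP a b) => // /ltW.
move=> s t /ivt[s' s01 ->] /ivt[t' t01 ->].
have [_ [_ <-]] := sc _ s01; have [_ [_ <-]] := sc _ t01.
by rewrite (le_lt_trans (pair_norm2 (c s' - c t'))) // dc.
Qed.

(* A path that leaves the compact arc A = unroll [0, 3] must do so through its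
   end point unroll 3: leaving through the segment would force x to increase
   from 0, hence y = sin (1/x) to take both values 1 and -1. *)
Lemma exit_time c : small_path 2 c -> A (c 0) -> ~ A (c 1) ->
  exists t0, [/\ 0 <= t0 <= 1, c t0 = unroll 3 &
    forall t, t0 <= t <= 1 -> sine_part R (c t)].
Proof.
move=> [cc Wc dc] A0 nA1.
pose E := [set t | 0 <= t <= 1 /\ A (c t)].
have E0 : E 0 by split=> //; lra.
have ubE : ubound E 1 by move=> t [/andP[]].
have supE : has_sup E by split; [exists 0|exists 1].
(* The last time in [A]: since [A] is closed it contains [c t0], while all later times lie on the
   sine curve, so [c t0] is a limit of points of that curve. *)
pose t0 := sup E.
have t01 : 0 <= t0 <= 1.
  by apply/andP; split; [exact: (ub_le_sup supE.2)|exact: (ge_sup supE.1)].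
have /within_continuousP cc' := cc.
have At0 : A (c t0).
  apply: A_closed; apply/closure_dist => e e0.
  have [|d d0 Hd] := cc' t0 _ e e0; first by rewrite /= in_itv.
  have [t Et tt] := sup_adherent d0 supE.
  have tt0 : t <= t0 by exact: (ub_le_sup supE.2).
  exists (c t); first by case: Et.
  apply: Hd; first by rewrite /= in_itv /=; case: Et.
  by rewrite ger0_norm ?subr_ge0 //; rewrite -/t0 in tt; lra.
have t0lt1 : t0 < 1.
  by rewrite lt_neqAle (andP t01).2 andbT; apply/eqP => e; rewrite e in At0.
have after t : t0 < t <= 1 -> sine_part R (c t).
  move=> /andP[tt t1]; apply: notA_sine; first by apply: Wc; lra.
  move=> At; have : t <= t0 by apply: (ub_le_sup supE.2); split=> //; lra.
  by rewrite leNgt tt.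
have cl : (sine_part R `|` seg_part R) (c t0).
  apply: sine_seg_closed; apply/closure_dist => e e0.
  have [|d d0 Hd] := cc' t0 _ e e0; first by rewrite /= in_itv.
  pose t := t0 + Num.min (d / 2) (1 - t0).
  have m0 : 0 < Num.min (d / 2) (1 - t0) by rewrite lt_min; lra.
  have m1 : Num.min (d / 2) (1 - t0) <= d / 2 by rewrite ge_min lexx.
  have m2 : Num.min (d / 2) (1 - t0) <= 1 - t0 by rewrite ge_min lexx orbT.
  exists (c t); first by left; apply: after; rewrite /t; lra.
  apply: Hd; first by rewrite /= in_itv /= /t; lra.
  by rewrite distrC ger0_norm /t; lra.
case: cl => [s0|[x0 _]].
  exists t0; split=> //; last first.
    by move=> t; rewrite le_eqVlt andb_orl => /orP[/andP[/eqP <-]|/after].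
  have [u3 u33 E3] := sine_unroll Hg s0; have [u /= u0 Eu] := At0.
  rewrite -Eu; congr unroll.
  have : u = u3 by apply: (unroll_inj Hg); rewrite ?Eu ?E3 //; lra.
  by lra.
exfalso; pose x1 := (c 1).1.
have x10 : 0 < x1 by case: (after 1) => //; rewrite t0lt1 lexx.
pose f t := (c t).1.
have fc : {within `[t0, 1], continuous f}.
  apply/within_continuousP => t; rewrite /= in_itv /= => tt e e0.
  have [|d d0 Hd] := cc' t _ e e0; first by rewrite /= in_itv /=; lra.
  exists d => // y; rewrite /= in_itv /= => yy ty.
  rewrite (le_lt_trans (pair_norm1 (c t - c y))) // Hd //.
  by rewrite /= in_itv /=; lra.
have hit w : x1^-1 <= w -> exists2 t, 0 <= t <= 1 & (c t).2 = sin w.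
  move=> xw; have w0 : 0 < w by rewrite (lt_le_trans _ xw) // invr_gt0.
  have [|t] := @IVT R f t0 1 w^-1 (ltW t0lt1) fc.
    rewrite /f x0 -/x1 (min_idPl (ltW x10)) (max_idPr (ltW x10)).
    by rewrite invr_ge0 (ltW w0) /= -[leRHS]invrK lef_pV2 ?posrE // invr_gt0.
  rewrite in_itv /= => tt ft; exists t; first lra.
  have [] := after t.
    rewrite (andP tt).2 andbT lt_neqAle (andP tt).1 andbT; apply/eqP => e.
    by move: ft; rewrite -e /f x0 => /eqP; rewrite eq_sym invr_eq0 gt_eqF.
  by move=> _ [_ ->]; rewrite -/(f t) ft invrK.
(* As 2*pi*n >= n >= 1/x1, the two phases below, shifted by n periods, are among the values reached
   by 1/x. *)
pose n := (Num.truncn x1^-1).+1.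
have nx : x1^-1 <= n%:R by rewrite ltW // truncnS_gt.
have pn : n%:R <= pi *+ 2 *+ n :> R.
  by rewrite -[leRHS]mulr_natr ler_peMl //; have := @pi_ge2 R; lra.
have h0 := @pi_gt0 R.
have [|t t1 ct] := hit (pi / 2 + pi *+ 2 *+ n); first lra.
have [|s s1 cs] := hit (pi / 2 + pi + pi *+ 2 *+ n); first lra.
move: ct cs; rewrite !(periodicn (@sinD2pi R)) sinDpi sin_pihalf => ct cs.
have := le_lt_trans (pair_norm2 (c t - c s)) (dc t s t1 s1).
rewrite /= ct cs opprK ltr_norml; lra.
Qed.

(** Two ends in [A] are compared by the uniform inverse, a path avoiding [A] by [sine_path_small],
    and a path changing sides passes through [unroll 3], at a cost of e/2 on either side. The bound
    2 on the diameter is the one of [exit_time]. *)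
Lemma small_path_height e : 0 < e -> exists2 d : R, 0 < d & forall c,
  small_path d c -> `|height (c 0) - height (c 1)| <= e.
Proof.
move=> e0; have e20 : 0 < e / 2 by lra.
have [d1 d10 H1] := sine_path_small e20.
have [d2 d20 H2] := unroll_inv_uniform 3 e20.
pose d := Num.min 2 (Num.min d1 d2).
have dd1 : d <= d1 by rewrite !ge_min lexx !orbT.
have dd2 : d <= d2 by rewrite !ge_min lexx !orbT.
exists d => [|c pc]; first by rewrite !lt_min d10 d20 ltr0n.
have weak d' c' : d <= d' -> small_path d c' -> small_path d' c'.
  by move=> dd [? ? h]; split=> // s t s1 t1; rewrite (lt_le_trans (h _ _ s1 t1)).
have d2' : d <= 2 by rewrite !ge_min lexx.
have aff0 (a b : R) : a + 0 * (b - a) = a by ring.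
have aff1 (a b : R) : a + 1 * (b - a) = b by ring.
have i1 : 0 <= (1 : R) <= 1 by lra.
have leave c' : small_path d c' -> A (c' 0) -> ~ A (c' 1) ->
    `|3 - height (c' 1)| <= e / 2.
  move=> pc' A0 nA1; have [t0 [t01 ct0 st0]] := exit_time (weak _ _ d2' pc') A0 nA1.
  have ps := small_path_sub (weak _ _ dd1 pc') t01 i1.
  have := H1 _ ps; rewrite /= aff0 aff1 ct0 (unrollK Hg); last lra.
  by apply=> t tt; apply: st0; nra.
have inA p r : A p -> A r -> `|p - r| < d -> `|height p - height r| <= e / 2.
  move=> [u /= u3 <-] [v /= v3 <-] uv.
  rewrite !(unrollK Hg) ?(andP u3).1 ?(andP v3).1 //.
  by apply/ltW/H2 => //; exact: lt_le_trans dd2.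
have A3 : A (unroll 3) by exists 3 => //=; lra.
have i0 : 0 <= (0 : R) <= 1 by lra.
have [pcc Wc dc] := pc.
have sub a b : 0 <= a <= 1 -> 0 <= b <= 1 -> A (c a) -> ~ A (c b) ->
    `|3 - height (c b)| <= e / 2.
  move=> a1 b1 Aa nAb; have := leave _ (small_path_sub pc a1 b1).
  by rewrite /= aff0 aff1; apply.
have mixed a b : 0 <= a <= 1 -> 0 <= b <= 1 -> A (c a) -> ~ A (c b) ->
    `|height (c a) - height (c b)| <= e.
  move=> a1 b1 Aa nAb.
  have [t0 [t01 ct0 _]] : exists t0, [/\ 0 <= t0 <= 1, c t0 = unroll 3 & True].
    have [|||t0 [t01 ct0 _]] := @exit_time (fun r => c (a + r * (b - a))).
    - exact: weak (small_path_sub pc a1 b1).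
    - by rewrite aff0.
    - by rewrite aff1.
    by exists (a + t0 * (b - a)); split=> //; nra.
  have h1 : `|height (c a) - 3| <= e / 2.
    have h3 : height (unroll 3) = 3 by rewrite (unrollK Hg) //; lra.
    by rewrite -{}h3; apply: inA => //; rewrite -ct0; exact: dc.
  have h2 := sub a b a1 b1 Aa nAb.
  by rewrite -(subrKA 3) (le_trans (ler_normD _ _)) //; lra.
have [A0|nA0] := pselect (A (c 0)); have [A1|nA1] := pselect (A (c 1)).
- by rewrite (le_trans (inA _ _ A0 A1 _)) ?dc //; lra.
- exact: mixed.
- by rewrite distrC; exact: mixed.
(* Both ends lie outside [A]. If the path visits [A], then from the visit towards either end it
   leaves through height 3. *)
have [[a a1 Aa]|nA] := pselect (exists2 a, 0 <= a <= 1 & A (c a)).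
  have h1 := sub a 0 a1 i0 Aa nA0; have h2 := sub a 1 a1 i1 Aa nA1.
  rewrite -(subrKA 3) (le_trans (ler_normD _ _)) // (distrC _ 3); lra.
rewrite (le_trans (H1 _ (weak _ _ dd1 pc) _)) //; last lra.
move=> t t1; apply: notA_sine; first exact: Wc.
by move=> At; apply: nA; exists t.
Qed.
End Paths.
End SmallPaths.

(** * Cones over lifted simplices *)

Section Lifts.
Context {R : realType}.
Implicit Types (X : set (R * R)) (k : nat).
Local Notation simp k := ('rV[R]_k.+1 -> R * R).

Lemma Delta_convex k (x y : 'rV[R]_k.+1) r : Delta R k x -> Delta R k y ->
  0 <= r <= 1 -> Delta R k (x + r *: (y - x)).
Proof.
move=> [x0 x1] [y0 y1] r01; split=> [i|].
  by rewrite !mxE; have := x0 i; have := y0 i; nra.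
under eq_bigr do rewrite !mxE.
by rewrite big_split /= -mulr_sumr sumrB x1 y1 subrr mulr0 addr0.
Qed.

(** The segment from [x] to [y] is cut into n+1 steps shorter than [d], since the simplex has
    diameter at most 1 in the sup norm. *)
Lemma bounded_oscillation k (h : 'rV[R]_k.+1 -> R) (d : R) n :
  (forall x y, Delta R k x -> Delta R k y -> `|x - y| < d -> `|h x - h y| < 1) ->
  n.+1%:R^-1 < d ->
  forall x y, Delta R k x -> Delta R k y -> `|h x - h y| <= n.+1%:R.
Proof.
move=> hd nd x y Dx Dy.
pose z (i : nat) := x + (i%:R / n.+1%:R) *: (y - x).
have n0 : 0 < n.+1%:R :> R by rewrite ltr0n.
have zD i : (i <= n.+1)%N -> Delta R k (z i).
  move=> il; apply: Delta_convex => //.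
  by rewrite divr_ge0 //= ler_pdivrMr // mul1r ler_nat.
have step i : (i <= n.+1)%N -> `|h x - h (z i)| <= i%:R.
  elim: i => [_|i IH il].
    by rewrite /z mul0r scale0r addr0 subrr normr0.
  rewrite -(subrKA (h (z i))) (le_trans (ler_normD _ _)) // -natr1 lerD ?IH //.
    exact: ltnW.
  apply/ltW/hd; [exact/zD/ltnW|exact: zD|].
  rewrite /z opprD addrACA subrr add0r -scalerBl normrZ -mulrBl -natr1.
  rewrite opprD addrA subrr add0r mulN1r normrN gtr0_norm ?invr_gt0 //.
  by rewrite (le_lt_trans _ nd) // ler_piMr ?invr_ge0 ?Delta_dist.
by have := step _ (leqnn n.+1); rewrite /z divff ?gt_eqF // scale1r (addrC x) subrK.
Qed.

(** The projection from vertex 0 onto the opposite face, in barycentric coordinates. *)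
Definition base k (x : 'rV[R]_k.+2) : 'rV[R]_k.+1 :=
  (1 - x ord0 ord0)^-1 *: \row_j x ord0 (lift ord0 j).

Lemma base_Delta k (x : 'rV[R]_k.+2) : Delta R k.+1 x -> x ord0 ord0 != 1 ->
  Delta R k (base x).
Proof.
move=> Dx x1; have /andP[_ xl] := Delta_coord ord0 Dx.
have x0 : 0 < 1 - x ord0 ord0 by rewrite subr_gt0 lt_neqAle x1.
case: Dx => h0 h1; split=> [i|].
  by rewrite !mxE mulr_ge0 // invr_ge0 ltW.
under eq_bigr do rewrite !mxE.
have S : \sum_(i < k.+1) x ord0 (lift ord0 i) = 1 - x ord0 ord0.
  by move: h1; rewrite big_ord_recl => <-; rewrite addrC addKr.
by rewrite -mulr_sumr S mulVf // gt_eqF.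
Qed.

(** Projection from the vertex has no Lipschitz constant near it, hence the factor 1 - x0. The 2
    accounts for the changes in coordinate i and in coordinate 0. *)
Lemma base_dist k (x y : 'rV[R]_k.+2) : Delta R k.+1 x -> Delta R k.+1 y ->
  x ord0 ord0 != 1 -> y ord0 ord0 != 1 ->
  (1 - x ord0 ord0) * `|base x - base y| <= 2 * `|x - y|.
Proof.
move=> Dx Dy x1 y1.
have x0 : 0 < 1 - x ord0 ord0.
  by rewrite subr_gt0 lt_neqAle x1; have /andP[] := Delta_coord ord0 Dx.
have y0 : 0 < 1 - y ord0 ord0.
  by rewrite subr_gt0 lt_neqAle y1; have /andP[] := Delta_coord ord0 Dy.
rewrite -ler_pdivlMl //; apply: rV_norm_le => [|i].
  by rewrite mulr_ge0 ?invr_ge0 ?(ltW x0) // mulr_ge0.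
rewrite ler_pdivlMl // -[X in X * _ <= _](gtr0_norm x0) -normrM.
have by01 := Delta_coord i (base_Delta Dy y1).
rewrite [X in _ * X]mxE [X in _ * (_ + X)]mxE.
have -> : (1 - x ord0 ord0) * (base x ord0 i - base y ord0 i) =
   (x ord0 (lift ord0 i) - y ord0 (lift ord0 i)) +
   (x ord0 ord0 - y ord0 ord0) * base y ord0 i.
  by rewrite !mxE; field; rewrite (gt_eqF x0) (gt_eqF y0).
rewrite (le_trans (ler_normD _ _)) //.
have h1 := rV_coord_le (x - y) (lift ord0 i).
have h2 := rV_coord_le (x - y) ord0.
rewrite !mxE in h1 h2; rewrite normrM.
rewrite (_ : 2 * _ = `|x - y| + `|x - y|); last by ring.
rewrite lerD // (le_trans _ h2) // ler_piMr // ger0_norm; lra.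
Qed.

Section Cone.
Variable gamma : R -> R * R.
Hypothesis Hg : warsaw_arc R gamma.
Local Notation W := (warsaw R gamma).
Local Notation unroll := (unroll gamma).
Local Notation height := (height gamma).

Definition lift_equicont k (F : set (simp k)) :=
  forall e : R, 0 < e -> exists2 d : R, 0 < d & forall s, F s -> forall x y,
    Delta R k x -> Delta R k y -> `|x - y| < d ->
    `|height (s x) - height (s y)| < e.

(** A segment between close points of the simplex is sent to a path of small diameter, to which
    [small_path_height] applies. *)
Lemma equicont_lift k (F : set (simp k)) : F `<=` sing R W k ->
  equicont F -> lift_equicont F.
Proof.
move=> FW eF e e0.
have [|d d0 Hd] := small_path_height Hg (_ : 0 < e / 2); first lra.
have [d' d'0 Hd'] := eF d d0.
exists d' => // s Fs x y Dx Dy xy.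
pose z r := x + r *: (y - x).
have zD r : 0 <= r <= 1 -> Delta R k (z r) by exact: Delta_convex.
have zdist r r' : 0 <= r <= 1 -> 0 <= r' <= 1 -> `|z r - z r'| <= `|r - r'| * `|x - y|.
  by move=> _ _; rewrite /z opprD addrACA subrr add0r -scalerBl normrZ (distrC x).
have := Hd (s \o z); rewrite /= /z scale0r addr0 scale1r (addrC x) subrK => H.
suff /H : small_path gamma d (s \o z) by lra.
split=> [|t t01|t t' t01 t'01] /=.
- apply/within_continuousP => r; rewrite /= in_itv /= => r01 e' e'0.
  have [d1 d10 Hd1] := eF e' e'0; exists d1 => // r'.
  rewrite in_itv /= => r'01 rr.
  apply: (Hd1 _ Fs); [exact: zD|exact: zD|].
  apply: le_lt_trans (zdist _ _ r01 r'01) _; apply: le_lt_trans rr.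
  by rewrite ler_piMr // Delta_dist.
- by apply: (sing_in (FW _ Fs)); exact: zD.
- apply: (Hd' _ Fs); [exact: zD|exact: zD|apply: le_lt_trans xy].
  apply: le_trans (zdist _ _ t01 t'01) _.
  by rewrite ler_piMl // ler_norml; lra.
Qed.

Lemma sing_lift_equicont k (s : simp k) : sing R W k s -> lift_equicont [set s].
Proof.
by move=> Ws; apply: equicont_lift (sing_equicont Ws) => _ ->.
Qed.

Lemma lift_equicont_equicont k (F : set (simp k)) :
  (forall s x, F s -> Delta R k x -> W (s x)) -> lift_equicont F -> equicont F.
Proof.
move=> FW eF e e0; have [d d0 Hd] := unroll_uniform Hg e0.
have [d' d'0 Hd'] := eF d d0; exists d' => // s Fs x y Dx Dy xy.
rewrite -(heightK Hg (FW _ _ Fs Dx)) -(heightK Hg (FW _ _ Fs Dy)).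
by apply/Hd/Hd'.
Qed.

Lemma lift_bounded k (F : set (simp k)) : lift_equicont F ->
  exists2 D : R, 0 < D & forall s x y, F s -> Delta R k x -> Delta R k y ->
    `|height (s x) - height (s y)| <= D.
Proof.
move=> eF; have [d d0 Hd] := eF 1 ltr01.
exists (Num.truncn d^-1).+1%:R => [|s x y Fs]; first by rewrite ltr0n.
apply: (@bounded_oscillation k (height \o s) d) => [|].
  exact: Hd.
by rewrite invf_plt ?posrE ?truncnS_gt.
Qed.

(* The join with the vertex [unroll p], taken affinely in the coordinate
   [height]. At the apex x0 = 1 the junk value of [base x] is multiplied by 0. *)
Definition cone k (p : R) (s : simp k) : simp k.+1 := fun x =>
  if `[< Delta R k.+1 x >]
  then unroll (p + (1 - x ord0 ord0) * (height (s (base x)) - p)) else 0.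

Lemma cone_arg_bounds k p N (s : simp k) x : Delta R k.+1 x -> 0 <= p <= N ->
  (forall y, Delta R k y -> 0 <= height (s y) <= N) ->
  0 <= p + (1 - x ord0 ord0) * (height (s (base x)) - p) <= N.
Proof.
move=> Dx pN sN; have := Delta_coord ord0 Dx.
have [->|x1] := eqVneq (x ord0 ord0) 1; first by rewrite subrr mul0r addr0.
by have := sN _ (base_Delta Dx x1); nra.
Qed.

Lemma height_cone k p (s : simp k) x : Delta R k.+1 x -> 0 <= p ->
  (forall y, Delta R k y -> W (s y)) ->
  height (cone p s x) = p + (1 - x ord0 ord0) * (height (s (base x)) - p).
Proof.
move=> Dx p0 sW; rewrite /cone asboolT // unrollK //.
have [x1|x1] := eqVneq (x ord0 ord0) 1; first by rewrite x1 subrr mul0r addr0.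
have := Delta_coord ord0 Dx.
by have := height_ge0 Hg (sW _ (base_Delta Dx x1)); nra.
Qed.

Lemma cone_in k p (s : simp k) x : Delta R k.+1 x -> 0 <= p ->
  (forall y, Delta R k y -> W (s y)) -> W (cone p s x).
Proof.
move=> Dx p0 sW; rewrite /cone asboolT //; apply: unroll_in => //.
have [x1|x1] := eqVneq (x ord0 ord0) 1; first by rewrite x1 subrr mul0r addr0.
have := Delta_coord ord0 Dx.
by have := height_ge0 Hg (sW _ (base_Delta Dx x1)); nra.
Qed.

(** Away from the apex [base] is Lipschitz; close to it the factor 1 - x0 damps the height
    differences, which [C] bounds. The need for a uniform [C] is why an apex must stay near its
    simplex. *)
Lemma cone_lift_equicont k (G : R -> set (simp k)) (C : R) :
  (forall p s, G p s -> 0 <= p /\ sing R W k s) ->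
  lift_equicont [set s | exists p, G p s] ->
  (forall p s y, G p s -> Delta R k y -> `|height (s y) - p| <= C) ->
  lift_equicont [set t | exists p s, G p s /\ t = cone p s].
Proof.
move=> GW eG GC e e0.
pose C' := Num.max C 1.
have C'0 : 0 < C' by rewrite lt_max ltr01 orbT.
have {}GC p s y : G p s -> Delta R k y -> `|height (s y) - p| <= C'.
  by move=> Gp Dy; rewrite le_max (GC p).
have [|d d0 Hd] := eG (e / 2); first lra.
(* eta * 2C' = e/2 settles the region 1 - x0 <= eta; beyond it, a distance below eta * d / 2 brings
   the bases within [d] by [base_dist]. *)
pose eta := e / (4 * C').
have eta0 : 0 < eta by rewrite divr_gt0 // mulr_gt0.
have c1 : 0 < e / (2 * C') by rewrite divr_gt0 // mulr_gt0.
have c2 : 0 < eta * d / 2 by rewrite divr_gt0 // mulr_gt0.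
exists (Num.min (e / (2 * C')) (eta * d / 2)); first by rewrite lt_min c1.
move=> _ [p [s [Gps ->]]] x y Dx Dy; rewrite lt_min => /andP[xy1 xy2].
have [p0 Ws] := GW _ _ Gps.
rewrite !height_cone //; try by move=> z; exact: sing_in Ws.
rewrite opprD addrACA subrr add0r.
have xy0 : `|x ord0 ord0 - y ord0 ord0| <= `|x - y|.
  by have := rV_coord_le (x - y) ord0; rewrite !mxE.
have xyC : `|x ord0 ord0 - y ord0 ord0| * C' < e / 2.
  rewrite -ltr_pdivlMr // (le_lt_trans xy0) // (lt_le_trans xy1) //.
  by rewrite invfM mulrA.
have x01 := Delta_coord ord0 Dx; have y01 := Delta_coord ord0 Dy.
have [x1|x1] := eqVneq (x ord0 ord0) 1.
  rewrite x1 subrr mul0r sub0r normrN normrM.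
  have [y1|y1] := eqVneq (y ord0 ord0) 1; first by rewrite y1 subrr normr0 mul0r.
  have h := GC p s _ Gps (base_Delta Dy y1).
  rewrite (le_lt_trans (ler_wpM2l (normr_ge0 _) h)) //.
  by move: xyC; rewrite x1; lra.
have [y1|y1] := eqVneq (y ord0 ord0) 1.
  rewrite y1 subrr mul0r subr0 normrM.
  have h := GC p s _ Gps (base_Delta Dx x1).
  rewrite (le_lt_trans (ler_wpM2l (normr_ge0 _) h)) //.
  by move: xyC; rewrite y1 distrC; lra.
set hx := height _; set hy := height (s (base y)).
have -> : (1 - x ord0 ord0) * (hx - p) - (1 - y ord0 ord0) * (hy - p) =
    (1 - x ord0 ord0) * (hx - hy) - (x ord0 ord0 - y ord0 ord0) * (hy - p) by ring.
rewrite (le_lt_trans (ler_normB _ _)) // !normrM.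
have hyC := GC p s _ Gps (base_Delta Dy y1); rewrite -/hy in hyC.
have hxC := GC p s _ Gps (base_Delta Dx x1); rewrite -/hx in hxC.
have h2 : `|x ord0 ord0 - y ord0 ord0| * `|hy - p| < e / 2.
  by rewrite (le_lt_trans _ xyC) // ler_wpM2l.
suff h1 : `|1 - x ord0 ord0| * `|hx - hy| <= e / 2 by lra.
rewrite ger0_norm; last lra.
case: (leP (1 - x ord0 ord0) eta) => xe.
  have hh : `|hx - hy| <= 2 * C'.
    rewrite (le_trans (ler_distD p _ _)) // (distrC p).
    by rewrite (_ : 2 * C' = C' + C') ?lerD //; ring.
  rewrite (_ : e / 2 = eta * (2 * C')); last first.
    by rewrite /eta; field; rewrite gt_eqF.
  by rewrite ler_pM //; lra.
have : `|hx - hy| < e / 2.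
  apply: (Hd s); [by exists p|exact: base_Delta|exact: base_Delta|].
  have := base_dist Dx Dy x1 y1.
  have hm : eta * `|base x - base y| <= (1 - x ord0 ord0) * `|base x - base y|.
    by rewrite ler_wpM2r // ltW.
  by rewrite -(ltr_pM2l eta0); lra.
by have := normr_ge0 (hx - hy); nra.
Qed.

Lemma cone_sing k p (s : simp k) : 0 <= p -> sing R W k s ->
  sing R W k.+1 (cone p s).
Proof.
move=> p0 Ws; have sW x := @sing_in _ _ _ s x Ws.
split; last split.
- have [C C0 HC] := lift_bounded (sing_lift_equicont Ws).
  pose v : 'rV[R]_k.+1 := \row_j (j == ord0)%:R.
  have Dv : Delta R k v.
    split=> [i|]; first by rewrite mxE.
    by rewrite (bigD1 ord0) //= big1 ?mxE ?addr0 // => i /negPf; rewrite mxE => ->.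
  have eq : lift_equicont [set t | exists p' s', (p' = p /\ s' = s) /\ t = cone p' s'].
    apply: (@cone_lift_equicont k (fun p' => [set s' | p' = p /\ s' = s])
      (C + `|height (s v) - p|)) => [_ _ [-> ->] //||p' s' y [-> ->] Dy].
      move=> e e0; have [d d0 Hd] := sing_lift_equicont Ws e0.
      by exists d => // s' [_ [_ ->]]; exact: Hd.
    by rewrite -(subrKA (height (s v))) (le_trans (ler_normD _ _)) // lerD // HC.
  apply/within_continuousP => x Dx e e0.
  have [t y [p' [s' [[-> ->] ->]]] Dy|d d0 Hd] := lift_equicont_equicont _ eq e0.
    exact: cone_in.
  by exists d => // y Dy; apply: Hd => //; exists p, s.
- by move=> _ [x Dx <-]; exact: cone_in.
- by move=> x nDx; rewrite /cone asboolF.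
Qed.

Lemma cone_face0 k p (s : simp k) : sing R W k s ->
  cone p s \o face R k ord0 = s.
Proof.
move=> Ws; apply/funext => x /=; rewrite /cone.
case: asboolP => Dx; last first.
  by case: Ws => _ [_ ->] //; rewrite -(face_Delta ord0).
rewrite face_self subr0 mul1r (addrC p) subrK.
have -> : base (face R k ord0 x) = x.
  rewrite /base face_self subr0 invr1 scale1r.
  by apply/rowP => j; rewrite mxE face_inj_sum.
by rewrite (heightK Hg) //; apply: (sing_in Ws); rewrite -(face_Delta ord0).
Qed.

Lemma face_lift0 k (i : 'I_k.+2) (x : 'rV[R]_k.+2) :
  face R k.+1 (lift ord0 i) x ord0 ord0 = x ord0 ord0.
Proof. by rewrite mxE /=; congr (x _ _); apply/val_inj; rewrite /= inordK. Qed.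

Lemma base_face k (i : 'I_k.+2) (x : 'rV[R]_k.+2) :
  base (face R k.+1 (lift ord0 i) x) = face R k i (base x).
Proof.
apply/rowP => j; rewrite /base face_lift0 [LHS]mxE [X in _ * X]mxE.
have [j' ->|->] := unliftP i j.
  have -> : lift ord0 (lift i j') = lift (lift ord0 i) (lift ord0 j').
    by apply/val_inj; rewrite /= /bump /= !add1n ltnS addnS.
  by rewrite !face_inj_sum !mxE.
by rewrite !face_self mulr0.
Qed.

Lemma cone_face k p (s : simp k.+1) i :
  cone p s \o face R k.+1 (lift ord0 i) = cone p (s \o face R k i).
Proof.
apply/funext => x /=; rewrite /cone face_lift0 base_face /=.
case: asboolP => [|nD]; first by rewrite face_Delta => Dx; rewrite asboolT.
by rewrite asboolF // => Dx; apply: nD; rewrite face_Delta.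
Qed.

(** Over a 0-simplex this face is the apex alone; the lemma replaces [cone_face] where the base has
    no face to pass to. *)
Lemma cone_point_face p (s t : simp 0) i :
  cone p s \o face R 0 (lift ord0 i) = cone p t \o face R 0 (lift ord0 i).
Proof.
apply/funext => x /=; rewrite /cone; case: asboolP => // /[dup] Dx; rewrite face_Delta => Dx'.
have -> : face R 0 (lift ord0 i) x ord0 ord0 = 1.
  rewrite (ord1 i) mxE /=; case: Dx' => _; rewrite big_ord1 => <-.
  by congr (x _ _); apply/val_inj; rewrite /= inordK.
by rewrite subrr !mul0r.
Qed.

Definition below k (N : R) : set (simp k) :=
  [set s | sing R W k s /\ forall x, Delta R k x -> height (s x) <= N].

(** Although [height] is not continuous, a bound on it says that the values lie in the image of
    [0, N] under [unroll], which is compact, hence closed. *)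
Lemma below_borel k N : co_borel R W k (below N).
Proof.
have cC : closed (unroll @` `[0, N]).
  apply: compact_closed; first exact: norm_hausdorff.
  apply: continuous_compact (@segment_compact _ _ _).
  apply/within_continuousP => u _ e e0.
  by have [d d0 Hd] := unroll_uniform Hg e0; exists d => // v _; exact: Hd.
have -> : below N = [set s | sing R W k s /\
    forall x, Delta R k x -> (unroll @` `[0, N]) (s x)].
  apply/seteqP; split=> s [Ws Hs]; split=> // x Dx.
    exists (height (s x)); last exact: heightK (sing_in Ws Dx).
    by rewrite /= in_itv /= Hs // (height_ge0 Hg) //; exact: sing_in Dx.
  have [u /=] := Hs x Dx; rewrite in_itv /= => /andP[u0 uN] <-.
  by rewrite unrollK.
exact: co_borel_closed.
Qed.

Lemma cone_below k p N (s : simp k) : 0 <= p <= N -> below N s ->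
  below N (cone p s).
Proof.
move=> /andP[p0 pN] [Ws sN]; split=> [|x Dx]; first exact: cone_sing.
rewrite height_cone //; last by move=> y; exact: sing_in.
suff /andP[] : 0 <= p + (1 - x ord0 ord0) * (height (s (base x)) - p) <= N by [].
apply: cone_arg_bounds => //; first by rewrite p0.
by move=> y Dy; rewrite sN // (height_ge0 Hg) //; exact: sing_in Dy.
Qed.

(** Restriction to [below N] supplies the bounded range on which the inverse of [unroll] is
    uniformly continuous, and there coning is continuous. *)
Lemma cone_borel k p N A : 0 <= p -> co_borel R W k.+1 A ->
  co_borel R W k (below N `&` (@cone k p) @^-1` A).
Proof.
move=> p0; apply: co_borel_preimage_continuous.
- exact: below_borel.
- by move=> s [Ws _]; exact: cone_sing.
move=> s [Ws sN] e e0; have [d d0 Hd] := unroll_uniform Hg e0.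
have [d' d'0 Hd'] := unroll_inv_uniform Hg N d0.
exists d' => // t [Wt tN] st x Dx; rewrite /cone asboolT //.
apply: Hd; rewrite opprD addrACA subrr add0r -mulrBr opprB addrA subrK.
have [->|x1] := eqVneq (x ord0 ord0) 1; first by rewrite subrr mul0r normr0.
have Dy := base_Delta Dx x1.
have xx := Delta_coord ord0 Dx.
rewrite normrM (le_lt_trans (_ : _ <= `|height (s (base x)) - height (t (base x))|)) //.
  by rewrite ler_piMl // ler_norml; lra.
have hs : 0 <= height (s (base x)) <= N by rewrite sN // (height_ge0 Hg) //; exact: sing_in Dy.
have ht : 0 <= height (t (base x)) <= N by rewrite tN // (height_ge0 Hg) //; exact: sing_in Dy.
apply: Hd' => //; rewrite !(heightK Hg); [exact: st|exact: sing_in Dy|exact: sing_in Dy].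
Qed.
End Cone.
End Lifts.

(** * The filling of a cycle *)

Section BlockDecomposition.
Context {R : realType}.
Implicit Types (X : set (R * R)) (k : nat).
Local Notation simp k := ('rV[R]_k.+1 -> R * R).

Section Blocks.
Variable gamma : R -> R * R.
Hypothesis Hg : warsaw_arc R gamma.
Local Notation W := (warsaw R gamma).
Local Notation height := (height gamma).
Local Notation cone := (cone gamma).
Local Notation below := (below gamma).
Variable D : R.
Hypothesis D0 : 0 < D.

Let vert (m : nat) : R := m%:R * D.

Let vert_ge0 m : 0 <= vert m.
Proof. by rewrite mulr_ge0 // ltW. Qed.

Let vert_le m n : (m <= n)%N -> vert m <= vert n.
Proof. by move=> mn; rewrite ler_pM2r // ler_nat. Qed.

Let vertS m : vert m.+1 = vert m + D.
Proof. by rewrite /vert -natr1 mulrDl mul1r. Qed.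

(** The default 0 occurs only for maps that are not singular simplices: by [lift_bounded] every
    singular simplex has bounded height. *)
Definition block k (s : simp k) : nat :=
  match pselect (exists m, `[< below (vert m.+1) s >]) with
  | left ex => ex_minn ex
  | right _ => 0%N
  end.

Lemma block_le k (s : simp k) m : sing R W k s ->
  (block s <= m)%N <-> below (vert m.+1) s.
Proof.
move=> Ws; have mono p q : (p <= q)%N -> below (vert p.+1) s -> below (vert q.+1) s.
  by move=> pq [_ h]; split=> // x /h /le_trans; apply; exact: vert_le.
rewrite /block; case: pselect => [ex|nex]; last first.
  exfalso; apply: nex; have [C C0 HC] := lift_bounded (sing_lift_equicont Hg Ws).
  have [[x Dx]|nD] := pselect (exists x, Delta R k x); last first.
    by exists 0%N; apply/asboolP; split=> // x Dx; exfalso; apply: nD; exists x.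
  exists (Num.truncn ((height (s x) + C) / D)); apply/asboolP; split=> // y Dy.
  have := HC s y x erefl Dy Dx; rewrite ler_norml => /andP[_ h].
  rewrite -ler_pdivrMr // ltW // (le_lt_trans _ (truncnS_gt _)) //.
  by rewrite ler_pM2r ?invr_gt0 //; lra.
case: ex_minnP => n /asboolP Hn nmin; split=> [nm|Hm].
  exact: mono Hn.
by apply: nmin; apply/asboolP.
Qed.

Lemma block_face k (s : simp k.+1) i : sing R W k.+1 s ->
  (block (s \o face R k i) <= block s)%N.
Proof.
move=> Ws; apply/block_le; first exact: sing_face.
have /block_le[] : (block s <= block s)%N by []. by [].
move=> _ h; split=> [|x Dx]; first exact: sing_face.
by apply: h; rewrite face_Delta.
Qed.

(** A face in block b lies below (b+1)D, and the oscillation is at most D, so the whole simplex lies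
    below (b+2)D. *)
Lemma block_small k (s : simp k.+1) i : sing R W k.+1 s ->
  (forall x y, Delta R k.+1 x -> Delta R k.+1 y ->
     `|height (s x) - height (s y)| <= D) ->
  (block s <= (block (s \o face R k i)).+1)%N.
Proof.
move=> Ws osc; apply/block_le => //; split=> // y Dy.
have [_ h] : below (vert (block (s \o face R k i)).+1) (s \o face R k i).
  by apply/block_le => //; exact: sing_face.
pose v : 'rV[R]_k.+1 := \row_j (j == ord0)%:R.
have Dv : Delta R k v.
  split=> [j|]; first by rewrite mxE.
  by rewrite (bigD1 ord0) //= big1 ?mxE ?addr0 // => j /negPf; rewrite mxE => ->.
have := h v Dv; rewrite /= !vertS.
have := osc y (face R k i v) Dy; rewrite face_Delta => /(_ Dv).
by rewrite ler_norml; lra.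
Qed.

(** Some point lies above the floor bD of the highest block met (for b = 0 heights are nonnegative
    anyway), and the oscillation is at most D. This provides the constant [C] of
    [cone_lift_equicont]. *)
Lemma block_height k (s : simp k) x : sing R W k s ->
  (forall x y, Delta R k x -> Delta R k y ->
     `|height (s x) - height (s y)| <= D) ->
  Delta R k x -> `|height (s x) - vert (block s)| <= D.
Proof.
move=> Ws osc Dx; have /(block_le _ Ws)[_ h] : (block s <= block s)%N by [].
have := h x Dx; rewrite vertS => hx.
rewrite ler_norml; apply/andP; split; last by lra.
case E : (block s) => [|n].
  have v0 : vert 0 = 0 by rewrite /vert mul0r.
  have h0 := height_ge0 Hg (sing_in Ws Dx).
  by rewrite v0 subr0 (le_trans _ h0) // oppr_le0 ltW.
have : ~ below (vert n.+1) s by move/(block_le _ Ws); rewrite E ltnn.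
move=> nb; have [y [Dy hy]] : exists y, Delta R k y /\ vert n.+1 < height (s y).
  apply: contrapT => ne; apply: nb; split=> // y Dy; rewrite leNgt; apply/negP => hy.
  by apply: ne; exists y.
by have := osc x y Dx Dy; rewrite ler_norml; lra.
Qed.

Lemma block_eq_borel k m : co_borel R W k [set s | sing R W k s /\ block s = m].
Proof.
have -> : [set s | sing R W k s /\ block s = m] =
    below (vert m.+1) `\` (if m is n.+1 then below (vert n.+1) else set0).
  apply/seteqP; split=> s.
    move=> [Ws E]; split; first by apply/block_le => //; rewrite E.
    case: m E => [|n] E /= Bs; first by [].
    by have := (block_le n Ws).2 Bs; rewrite E ltnn.
  move=> [Bs nB]; have Ws : sing R W k s by case: Bs.
  split=> //; move/(block_le _ Ws): Bs; case: m nB => [|n] nB.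
    by rewrite leqn0 => /eqP.
  rewrite leq_eqVlt => /orP[/eqP //|].
  by rewrite ltnS => /(block_le _ Ws)/nB.
apply: co_borelD; first exact: below_borel.
by case: m => [|n]; [exact: co_borel0|exact: below_borel].
Qed.

Lemma block_lt_borel k m :
  co_borel R W k [set s | sing R W k s /\ (block s < m)%N].
Proof.
case: m => [|m].
  by rewrite (_ : mkset _ = set0) -?subset0; [exact: co_borel0|move=> s []].
rewrite (_ : mkset _ = below (vert m.+1)); first exact: below_borel.
apply/seteqP; split=> s; first by move=> [Ws]; rewrite ltnS => /(block_le _ Ws).
by move=> Bs; have Ws := Bs.1; split=> //; rewrite ltnS; apply/block_le.
Qed.

(** The index takes countably many values, each on a Borel set, so maps chosen block by block glue
    to a Borel map despite the jumps. *)
Lemma block_borel k l (f : nat -> simp k -> simp l) A :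
  (forall m, co_borel R W k (below (vert m.+1) `&` f m @^-1` A)) ->
  co_borel R W k (sing R W k `&` [set s | A (f (block s) s)]).
Proof.
move=> bf; rewrite (_ : _ `&` _ = \bigcup_m
    ([set s | sing R W k s /\ block s = m] `&` (below (vert m.+1) `&` f m @^-1` A))).
  by apply: co_borel_bigcup => m; apply: co_borelI => //; exact: block_eq_borel.
apply/seteqP; split=> s.
  by move=> [Ws As]; exists (block s) => //; do 2?split=> //; apply/block_le.
by move=> [m _ [[Ws <-] [_ As]]].
Qed.

Lemma cone2_borel k m A : co_borel R W k.+2 A ->
  co_borel R W k (below (vert m.+1) `&`
    [set s | A (cone (vert m.+1) (cone (vert m) s))]).
Proof.
move=> bA; rewrite (_ : _ `&` _ = below (vert m.+1) `&` (@cone k (vert m)) @^-1`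
    (below (vert m.+1) `&` (@cone k.+1 (vert m.+1)) @^-1` A)).
  by apply: cone_borel => //; exact: cone_borel.
apply/seteqP; split=> s [Bs]; last by move=> [].
by split=> //; split=> //; apply: cone_below => //; rewrite vert_ge0 vert_le.
Qed.

(** The identity of [face_face] carried under a cone, with the natural indices of
    [alternating_double_sum]. For k = 0 only the apex remains. *)
Lemma cone_face_swap k p (s : simp k.+1) i j : (j < i <= k.+1)%N ->
  cone p (s \o face R k (inord i)) \o face R k (lift ord0 (inord j)) =
  cone p (s \o face R k (inord j)) \o face R k (lift ord0 (inord i.-1)).
Proof.
case: k s => [|k] s /andP[ji ik].
  have -> : (inord j : 'I_1) = inord i.-1 by rewrite [LHS]ord1 [RHS]ord1.
  exact: cone_point_face.
rewrite !cone_face; congr (cone _ _); apply/funext => x /=; congr s.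
have jk : (j < k.+2)%N by exact: leq_trans ik.
have ik' : (i < k.+3)%N by rewrite ltnS.
rewrite face_face; last by rewrite (inordK jk) (inordK ik').
rewrite (inordK ik'); congr (face _ _ _ _); apply/val_inj.
by rewrite /= (inordK jk) inordK // ltnW.
Qed.

Section Filling.
Variables (m : nat) (mu : set (simp m.+1) -> R) (K : set (simp m.+1)).
Hypothesis mu_add : sigma_additive W mu.
Hypothesis muK : carried W mu K.
Hypothesis KW : K `<=` sing R W m.+1.
Hypothesis eK : equicont K.
Hypothesis oscK : forall s x y, K s -> Delta R m.+1 x -> Delta R m.+1 y ->
  `|height (s x) - height (s y)| <= D.
Hypothesis cycle : forall A, co_borel R W m A -> mt_boundary R W m mu A = 0.

Let stay (i : 'I_m.+2) : set (simp m.+1) :=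
  [set s | sing R W m.+1 s /\ block (s \o face R m i) = block s].

Let stay_borel i : co_borel R W m.+1 (stay i).
Proof.
rewrite (_ : stay i = \bigcup_b ([set s | sing R W m.+1 s /\ block s = b] `&`
   [set s | sing R W m.+1 s /\
      [set t | sing R W m t /\ block t = b] (s \o face R m i)])).
  apply: co_borel_bigcup => b; apply: co_borelI; first exact: block_eq_borel.
  by apply: co_borel_face; exact: block_eq_borel.
apply/seteqP; split=> s.
  by move=> [Ws E]; exists (block s) => //; split=> //; split=> //; split=> //; exact: sing_face.
by move=> [b _ [[Ws <-] [_ [_ E]]]].
Qed.

Let face_borel i B : co_borel R W m B ->
  co_borel R W m.+1 [set s | stay i s /\ B (s \o face R m i)].
Proof.
move=> bB; rewrite (_ : mkset _ = stay i `&`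
    [set s | sing R W m.+1 s /\ B (s \o face R m i)]).
  by apply: co_borelI => //; exact: co_borel_face.
by apply/seteqP; split=> s [[Ws E] H]; split=> //; case: H.
Qed.

Definition near_cone (k : nat) (s : simp k) := cone (vert (block s)) s.
(** For a face one block below its simplex, this apex is the one of the simplex. *)
Definition far_cone (k : nat) (s : simp k) := cone (vert (block s).+1) s.
(** Its face opposite p_(b+1) is the near cone, its face opposite p_b the far cone. *)
Definition edge_join (k : nat) (s : simp k) :=
  cone (vert (block s).+1) (near_cone s).

Let near_cone_borel k A : co_borel R W k.+1 A ->
  co_borel R W k (sing R W k `&` (@near_cone k) @^-1` A).
Proof.
move=> bA; apply: (@block_borel k k.+1 (fun b s => cone (vert b) s)) => b.
exact: cone_borel.
Qed.

Let far_cone_borel k A : co_borel R W k.+1 A ->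
  co_borel R W k (sing R W k `&` (@far_cone k) @^-1` A).
Proof.
move=> bA; apply: (@block_borel k k.+1 (fun b s => cone (vert b.+1) s)) => b.
exact: cone_borel.
Qed.

Let edge_join_borel k A : co_borel R W k.+2 A ->
  co_borel R W k (sing R W k `&` (@edge_join k) @^-1` A).
Proof.
move=> bA; apply: (@block_borel k k.+2
  (fun b s => cone (vert b.+1) (cone (vert b) s))) => b.
exact: cone2_borel.
Qed.

Definition filling (A : set (simp m.+2)) : R :=
  mu (sing R W m.+1 `&` (@near_cone m.+1) @^-1` A) +
  \sum_(i < m.+2) (-1) ^+ i *
    mu (stay i `&` (fun s : simp m.+1 => edge_join (s \o face R m i)) @^-1` A).

Let face_osc s i x y : K s -> Delta R m x -> Delta R m y ->
  `|height ((s \o face R m i) x) - height ((s \o face R m i) y)| <= D.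
Proof. by move=> Ks Dx Dy; apply: oscK; rewrite ?face_Delta. Qed.

Lemma filling_chain : mt_chain R W m.+2 filling.
Proof.
apply: mt_chainD.
  pose G p := [set s | K s /\ p = vert (block s)].
  have eG : lift_equicont gamma [set t | exists p s, G p s /\ t = cone p s].
    apply: (@cone_lift_equicont _ _ Hg _ G D) => [p s [Ks ->]||p s y [Ks ->] Dy].
    - by split=> //; exact: KW.
    - move=> e e0; have [d d0 Hd] := equicont_lift Hg KW eK e0.
      by exists d => // s [p [Ks _]]; exact: Hd.
    - by apply: block_height Dy => [|x z Dx Dz]; [exact: KW|exact: oscK].
  have GW t : (exists p s, G p s /\ t = cone p s) -> sing R W m.+2 t.
    by move=> [p [s [[Ks ->] ->]]]; apply: cone_sing => //; exact: KW.
  have [L cL GL] := equicont_co_compact (warsaw_compact Hg) GW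
    (lift_equicont_equicont Hg (fun s x Gs => sing_in (GW s Gs)) eG).
  apply: (mt_chain_push mu_add muK cL) => [A|s Ks _]; first exact: near_cone_borel.
  by apply: GL; exists (vert (block s)), s.
apply: mt_chain_sum => i; apply: mt_chainZ.
have fK : [set s \o face R m j | s in K & j in [set: 'I_m.+2]] `<=` sing R W m.
  by move=> _ [s Ks [j _ <-]]; apply: sing_face; exact: KW.
pose G p := [set t | exists s, [/\ K s, t = s \o face R m i & p = vert (block t)]].
have eG : lift_equicont gamma [set t | exists p s, G p s /\ t = cone p s].
  apply: (@cone_lift_equicont _ _ Hg _ G D) => [p t [s [Ks -> ->]]||p t y [s [Ks -> ->]] Dy].
  - by split=> //; apply: sing_face; exact: KW.
  - move=> e e0; have [d d0 Hd] := equicont_lift Hg fK (equicont_face eK) e0.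
    exists d => // t [p [s [Ks -> _]]]; apply: Hd.
    by exists s => //; exists i.
  - apply: block_height Dy => [|x z Dx Dz]; last exact: face_osc.
    by apply: sing_face; exact: KW.
pose G' p := [set u | exists s, [/\ K s, u = near_cone (s \o face R m i) &
  p = vert (block (s \o face R m i)).+1]].
have WG' s : K s -> sing R W m (s \o face R m i).
  by move=> Ks; apply: sing_face; exact: KW.
have eG' : lift_equicont gamma [set t | exists p s, G' p s /\ t = cone p s].
  (* The near cone stays within D of p_b, and p_(b+1) is another D away. *)
  apply: (@cone_lift_equicont _ _ Hg _ G' (2 * D)) => [p t [s [Ks -> ->]]||p t y [s [Ks -> ->]] Dy].
  - by split=> //; apply: cone_sing => //; exact: WG'.
  - move=> e e0; have [d d0 Hd] := eG e e0; exists d => // t [p [s [Ks -> _]]].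
    apply: Hd; exists (vert (block (s \o face R m i))), (s \o face R m i).
    by split=> //; exists s.
  - rewrite /near_cone height_cone //; last first.
      by move=> z; apply: sing_in; exact: WG'.
    rewrite vertS.
    have addKB (a c : R) : a + c - (a + D) = c - D by ring.
    rewrite addKB (le_trans (ler_normB _ _)) // (gtr0_norm D0).
    have := Delta_coord ord0 Dy.
    have [->|y1] := eqVneq (y ord0 ord0) 1; first by rewrite subrr mul0r normr0 add0r => _; have := D0; lra.
    move=> yy; rewrite normrM.
    have hD : `|height ((s \o face R m i) (base y)) - vert (block (s \o face R m i))| <= D.
      apply: block_height (base_Delta Dy y1); first exact: WG'.
      by move=> x z; exact: face_osc.
    have h1 : 0 <= 1 - y ord0 ord0 <= 1 by lra.
    rewrite (ger0_norm (andP h1).1).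
    by have := ler_pM (andP h1).1 (normr_ge0 _) (andP h1).2 hD; rewrite mul1r; lra.
have GW' t : (exists p s, G' p s /\ t = cone p s) -> sing R W m.+2 t.
  move=> [p [u [[s [Ks -> ->]] ->]]]; apply: cone_sing => //.
  by apply: cone_sing => //; exact: WG'.
have [L cL GL] := equicont_co_compact (warsaw_compact Hg) GW'
  (lift_equicont_equicont Hg (fun s x Gs => sing_in (GW' s Gs)) eG').
apply: (mt_chain_push mu_add muK cL) => [A bA|s Ks _].
  rewrite (_ : _ `&` _ = [set s | stay i s /\
      (sing R W m `&` (@edge_join m) @^-1` A) (s \o face R m i)]).
    by apply: face_borel; exact: edge_join_borel.
  apply/seteqP; split=> s; last by move=> [? []].
  by move=> [[Ws E] As]; split=> //; split=> //; exact: sing_face.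
by apply: GL; exists (vert (block (s \o face R m i)).+1), (near_cone (s \o face R m i));
  split=> //; exists s.
Qed.

(** Add the cycle condition restricted to faces of index less than b. On the carrier these belong to
    simplices of index at most b, by [block_small]; the other faces of such simplices lie in block b
    and stay. *)
Lemma localized_cycle b B : co_borel R W m B ->
  \sum_(i < m.+2) (-1) ^+ i * mu [set s | stay i s /\
     (sing R W m (s \o face R m i) /\ block (s \o face R m i) = b) /\
     B (s \o face R m i)] =
  \sum_(i < m.+2) (-1) ^+ i * mu [set s | below (vert b.+1) s /\ B (s \o face R m i)].
Proof.
move=> bB.
pose eqb := [set t | sing R W m t /\ block t = b].
pose ltb := [set t | sing R W m t /\ (block t < b)%N].
have bX i : co_borel R W m.+1 [set s | below (vert b.+1) s /\ B (s \o face R m i)].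
  rewrite (_ : mkset _ = below (vert b.+1) `&`
      [set s | sing R W m.+1 s /\ B (s \o face R m i)]).
    by apply: co_borelI; [exact: below_borel|exact: co_borel_face].
  by apply/seteqP; split=> s [Bs]; [split=> //; split=> //; exact: Bs.1|case].
have bY i : co_borel R W m.+1 [set s | sing R W m.+1 s /\ eqb (s \o face R m i)].
  by apply: co_borel_face; exact: block_eq_borel.
have bZ : co_borel R W m (B `&` ltb) by apply: co_borelI => //; exact: block_lt_borel.
have c0 := cycle bZ; rewrite /mt_boundary in c0.
rewrite -[LHS]addr0 -[X in _ + X]c0. rewrite -big_split /=.
apply: eq_bigr => i _; rewrite -mulrDr; congr (_ * _).
rewrite (sigma_additiveID mu_add (bX i) (bY i)); congr (_ + _).
  congr mu; apply/seteqP; split=> s.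
    move=> [[Ws E] [[Wf Eb] Bf]]; split; split=> //.
    by apply/block_le => //; rewrite -E Eb.
  move=> [[Bs Bf] [Ws [Wf Eb]]]; split=> //; split=> //; apply/eqP.
  rewrite eqn_leq block_face //= Eb; exact/block_le.
apply: (carried_eq mu_add muK).
- exact: (co_borel_face i bZ).
- exact: co_borelD.
move=> s Ks; have Ws := KW Ks; have Wf := sing_face i Ws.
split.
  move=> [_ [Bf [_ lb]]]; split; last by move=> [_ [_ E]]; move: lb; rewrite E ltnn.
  split=> //; apply/block_le => //; apply: leq_trans lb.
  by apply: block_small => // x y; exact: oscK.
move=> [[Bs Bf] nE]; split=> //; split=> //; split=> //.
rewrite ltn_neqAle; apply/andP; split.
  by apply/eqP => E; apply: nE.
by rewrite (leq_trans (block_face i Ws)) //; exact/block_le.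
Qed.

(** Sorting by the block of the face fixes both apexes. [localized_cycle] then sums over all faces
    of the simplices of index at most b, and the double faces cancel in pairs. *)
Let rest_eq0 A : co_borel R W m.+1 A ->
  \sum_(j < m.+1) \sum_(i < m.+2) (-1) ^+ j * ((-1) ^+ i *
    mu [set s | stay i s /\ A (cone (vert (block (s \o face R m i)).+1)
      (cone (vert (block (s \o face R m i))) (s \o face R m i) \o
         face R m (lift ord0 j)))]) = 0.
Proof.
(* The condition [below] makes [B b j] Borel and holds for every face in block b. *)
move=> bA; pose B b (j : 'I_m.+1) := [set t | below (vert b.+1) t /\
  A (cone (vert b.+1) (cone (vert b) t \o face R m (lift ord0 j)))].
have bB b j : co_borel R W m (B b j).
  pose A' := [set u | below (vert b.+1) u /\ A (cone (vert b.+1) u)].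
  have bA' : co_borel R W m A' by exact: cone_borel.
  pose A'' := [set u | sing R W m.+1 u /\ A' (u \o face R m (lift ord0 j))].
  have bA'' : co_borel R W m.+1 A'' by exact: co_borel_face.
  rewrite (_ : B b j = below (vert b.+1) `&` (@cone m (vert b)) @^-1` A'').
    exact: cone_borel.
  apply/seteqP; split=> t [Bt]; last by move=> [_ []].
  have Bc : below (vert b.+1) (cone (vert b) t).
    by apply: cone_below => //; rewrite vert_ge0 vert_le.
  move=> At; split=> //; split; first exact: Bc.1.
  split=> //; split; first by apply: sing_face; exact: Bc.1.
  by move=> x Dx; apply: Bc.2; rewrite face_Delta.
pose S (p : 'I_m.+1 * 'I_m.+2) b := [set s | stay p.2 s /\
   (sing R W m (s \o face R m p.2) /\ block (s \o face R m p.2) = b) /\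
   B b p.1 (s \o face R m p.2)].
have bS p b : co_borel R W m.+1 (S p b).
  apply: (@face_borel p.2 ([set t | sing R W m t /\ block t = b] `&` B b p.1)).
  by apply: co_borelI => //; exact: block_eq_borel.
have tS p : trivIset setT (S p).
  apply/trivIsetP => b b' _ _ bb; rewrite -subset0 => s [].
  by move=> [_ [[_ E] _]] [_ [[_ E'] _]]; move: bb; rewrite -E -E' eqxx.
rewrite pair_big /=.
under eq_bigr => p _.
  rewrite mulrA (_ : mkset _ = \bigcup_b S p b).
    over.
  apply/seteqP; split=> s.
    move=> [st As]; exists (block (s \o face R m p.2)) => //; split=> //.
    have Wf : sing R W m (s \o face R m p.2) by apply: sing_face; case: st.
    by split=> //; split=> //; apply/block_le.
  by move=> [b _ [st [[_ <-] [_ As]]]].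
apply: (sigma_additive_sum_eq0 mu_add) => // b.
rewrite -(pair_big xpredT xpredT (fun (j : 'I_m.+1) (i : 'I_m.+2) => (-1) ^+ j * (-1) ^+ i * mu (S (j, i) b))) /=.
under eq_bigr => j _.
  under eq_bigr do rewrite -mulrA.
  rewrite -mulr_sumr (localized_cycle b (bB b j)) mulr_sumr.
  over.
rewrite exchange_big /=.
pose g (s : simp m.+1) i j := cone (vert b.+1) (cone (vert b)
  (s \o face R m (inord i)) \o face R m (lift ord0 (inord j))).
pose f i j := mu [set s | below (vert b.+1) s /\ A (g s i j)].
transitivity (\sum_(i < m.+2) \sum_(j < m.+1) (-1) ^+ i * ((-1) ^+ j * f i j)).
  apply: eq_bigr => i _; apply: eq_bigr => j _; rewrite mulrCA; congr (_ * (_ * mu _)).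
  apply/seteqP; split=> s [Bs]; rewrite /g /= !inord_val.
    by move=> [_].
  move=> As; split=> //; split=> //; split; first by apply: sing_face; case: Bs.
  by move=> x Dx; apply: Bs.2; rewrite face_Delta.
apply: alternating_double_sum => i j /andP[ji im].
have E s : g s i j = g s j i.-1.
  by rewrite /g cone_face_swap ?ji.
rewrite /f; apply: (congr1 mu); apply/seteqP; split=> s [Bs As].
  by split; [exact: Bs|rewrite -E; exact: As].
by split; [exact: Bs|rewrite E; exact: As].
Qed.

(** The joins turn the near cones over staying faces into far ones. What is then subtracted from
    [mu] is its boundary tested on the preimage of [A] under [far_cone], which vanishes. *)
Lemma filling_boundary A : co_borel R W m.+1 A ->
  mt_boundary R W m.+1 filling A = mu A.
Proof.
move=> bA; have AW := co_borel_sub bA.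
pose P i := [set s | sing R W m.+1 s /\ A (cone (vert (block s)) (s \o face R m i))].
pose N i := [set s | stay i s /\ (sing R W m `&` (@near_cone m) @^-1` A) (s \o face R m i)].
pose F i := [set s | stay i s /\ (sing R W m `&` (@far_cone m) @^-1` A) (s \o face R m i)].
pose Q i := [set s | sing R W m.+1 s /\ (sing R W m `&` (@far_cone m) @^-1` A) (s \o face R m i)].
have bF i : co_borel R W m.+1 (F i) by apply: face_borel; exact: far_cone_borel.
have bQ i : co_borel R W m.+1 (Q i) by apply: co_borel_face; exact: far_cone_borel.
have near_sing s : sing R W m.+1 s -> sing R W m.+2 (near_cone s).
  by move=> Ws; exact: cone_sing.
have join_sing i s : sing R W m.+1 s -> sing R W m.+2 (edge_join (s \o face R m i)).
  by move=> Ws; apply: cone_sing => //; apply: cone_sing => //; exact: sing_face.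
have bP i : co_borel R W m.+1 (P i).
  rewrite (_ : P i = sing R W m.+1 `&` (@near_cone m.+1) @^-1`
      [set t | sing R W m.+2 t /\ A (t \o face R m.+1 (lift ord0 i))]).
    by apply: near_cone_borel; exact: co_borel_face.
  apply/seteqP; split=> s; rewrite /P /near_cone /= cone_face.
    by move=> [Ws As]; split=> //; split=> //; exact: near_sing.
  by move=> [Ws [_ As]].
(* A staying face gives its near cone; a face t dropping one block gives its far cone, because then
   p_b(s) = p_(b(t)+1). *)
have PNQ i : mu (P i) = mu (N i) + mu (Q i `\` F i).
  rewrite (sigma_additiveID mu_add (bP i) (stay_borel i)); congr (_ + _).
    congr mu; apply/seteqP; split=> s.
      move=> [[Ws As] [_ E]]; split=> //; split; first exact: sing_face.
      by rewrite /near_cone /= E.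
    by move=> [[Ws E] [_ As]]; split; split=> //; move: As; rewrite /near_cone /= E.
  apply: (carried_eq mu_add muK); [exact: co_borelD|exact: co_borelD|].
  move=> s Ks; have Ws := KW Ks; have Wf := sing_face i Ws.
  have low := block_face i Ws.
  have up : (block s <= (block (s \o face R m i)).+1)%N.
    by apply: block_small => // x y; exact: oscK.
  have far : ~ stay i s -> block s = (block (s \o face R m i)).+1.
    move=> nE; apply/eqP; rewrite eqn_leq up ltn_neqAle low andbT.
    by apply/eqP => E; apply: nE.
  split=> [[[_ As] nE]|[[_ [_ As]] nF]].
    split=> [|[/nE //]]; split=> //; split=> //.
    by rewrite /far_cone /= -far.
  have nE : ~ stay i s by move=> st; apply: nF.
  by split=> //; split=> //; rewrite far.
have QF i : mu (Q i) = mu (F i) + mu (Q i `\` F i).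
  rewrite (sigma_additiveID mu_add (bQ i) (bF i)); congr (mu _ + _).
  by apply/setIidPr => s [[Ws _] h].
have cQ := cycle (far_cone_borel bA); rewrite /mt_boundary in cQ.
have {}cQ : \sum_(i < m.+2) (-1) ^+ i * mu (F i) +
    \sum_(i < m.+2) (-1) ^+ i * mu (Q i `\` F i) = 0.
  rewrite -[RHS]cQ -big_split /=; apply: eq_bigr => i _.
  by rewrite -mulrDr -QF.
have first_part : \sum_(l < m.+3) (-1) ^+ l * mu (sing R W m.+1 `&`
    (@near_cone m.+1) @^-1` [set t | sing R W m.+2 t /\ A (t \o face R m.+1 l)]) =
    mu A - (\sum_(i < m.+2) (-1) ^+ i * mu (N i) +
            \sum_(i < m.+2) (-1) ^+ i * mu (Q i `\` F i)).
  rewrite big_ord_recl /= mul1r; congr (_ + _).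
    congr mu; apply/seteqP; split=> s.
      by move=> [Ws [_]]; rewrite /near_cone cone_face0.
    move=> As; have Ws := AW _ As; split=> //; split; first exact: near_sing.
    by rewrite /near_cone cone_face0.
  rewrite -big_split /= -sumrN; apply: eq_bigr => i _.
  rewrite -mulrDr -PNQ exprS mulN1r mulNr; congr (- (_ * mu _)).
  apply/seteqP; split=> s; rewrite /P /near_cone /=.
    by rewrite cone_face => -[Ws [_ As]].
  by move=> [Ws As]; split=> //; split; [exact: near_sing|rewrite cone_face].
have second_part : \sum_(l < m.+3) (-1) ^+ l * (\sum_(i < m.+2) (-1) ^+ i *
      mu (stay i `&` (fun s : simp m.+1 => edge_join (s \o face R m i)) @^-1`
        [set t | sing R W m.+2 t /\ A (t \o face R m.+1 l)])) =
    \sum_(i < m.+2) (-1) ^+ i * mu (N i) - \sum_(i < m.+2) (-1) ^+ i * mu (F i).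
  rewrite big_ord_recl big_ord_recl /= mul1r addrA -[RHS]addr0; congr (_ + _ + _).
  - apply: eq_bigr => i _; congr (_ * mu _); apply/seteqP; split=> s.
      move=> [[Ws E] [_]]; have Wf := sing_face i Ws.
      have cs := cone_sing Hg (vert_ge0 (block (s \o face R m i))) Wf.
      by rewrite /edge_join (cone_face0 Hg _ cs); split.
    move=> [[Ws E] [Wf As]]; split=> //; split; first exact: join_sing.
    have cs := cone_sing Hg (vert_ge0 (block (s \o face R m i))) Wf.
    by rewrite /edge_join (cone_face0 Hg _ cs).
  - rewrite expr1 mulN1r; congr (- _).
    apply: eq_bigr => i _; congr (_ * mu _); apply/seteqP; split=> s.
      move=> [[Ws E] [_]]; have Wf := sing_face i Ws.
      by rewrite /edge_join cone_face /near_cone cone_face0.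
    move=> [[Ws E] [Wf As]]; split=> //; split; first exact: join_sing.
    by rewrite /edge_join cone_face /near_cone cone_face0.
  - rewrite -[RHS](rest_eq0 bA); apply: eq_bigr => j _.
    have -> : (-1) ^+ bump 0 (bump 0 j) = (-1) ^+ j :> R.
      by rewrite /bump !add1n !exprS mulrA mulrNN !mul1r.
    rewrite mulr_sumr.
    apply: eq_bigr => i _; congr (_ * (_ * mu _)); apply/seteqP; split=> s.
      by move=> [[Ws E] [_]]; rewrite /edge_join cone_face.
    move=> [[Ws E] As]; split; first by split.
    split; first exact: join_sing.
    by rewrite /edge_join /= cone_face; exact: As.
rewrite /mt_boundary /filling.
under eq_bigr do rewrite mulrDr.
rewrite big_split /= first_part second_part; lra.
Qed.
End Filling.
End Blocks.
End BlockDecomposition.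

(* For every arc gamma completing the Warsaw circle W, the Milnor-Thurston
   homology H_n(W) vanishes for every n > 0 (n = m+1). *)
Theorem theorem3 (R : realType) (gamma : R -> R * R) :
  warsaw_arc R gamma ->
  forall m : nat, mt_homology_succ_vanishes R (warsaw R gamma) m.
Proof.
move=> Hg m mu /mt_chainP[mu_add [K cK muK]] cyc.
have eK := co_compact_equicont cK.
(* The oscillation bound of the carrier becomes the block length. *)
have [D D0 oscK] := lift_bounded (equicont_lift Hg cK.1 eK).
exists (filling gamma D mu); split.
  exact: (filling_chain Hg D0 mu_add muK cK.1 eK oscK).
by move=> A; exact: (filling_boundary Hg D0 mu_add muK cK.1 oscK cyc).
Qed.
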